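(* For every $0<\epsilon<\frac12$ there exists an (explicit) constant $c_\epsilon>0$, depending only on $\epsilon$, such that every lazy irreducible discrete-time birth-and-death chain satisfies $$t_{\mathrm{mix}}(\epsilon)-t_{\mathrm{mix}}(1-\epsilon)\le c_\epsilon\sqrt{t_{\mathrm{rel}}\cdot t_{\mathrm{mix}}(\tfrac14)}.$$
   Context: A (discrete-time) birth-and-death chain is a Markov chain with state space $\Omega=\{0,\ldots,n\}$ for some integer $n\ge 1$ whose transition kernel $P$ satisfies $P(x,y)=0$ whenever $|x-y|>1$. It is lazy if $P(x,x)\ge\frac12$ for all $x\in\Omega$. Let $\pi$ be the stationary distribution. The total-variation distance is $\|\mu-\nu\|_{\mathrm{TV}}=\frac12\sum_{x}|\mu(x)-\nu(x)|$. Put $d(t)=\max_{x\in\Omega}\|P^t(x,\cdot)-\pi\|_{\mathrm{TV}}$ for integers $t\ge0$, and $t_{\mathrm{mix}}(\epsilon)=\min\{t: d(t)\le\epsilon\}$ for $0<\epsilon<1$. The spectral gap is $\mathrm{gap}=1-\lambda$, where $\lambda$ is the largest absolute value of all nontrivial eigenvalues of $P$ (i.e. eigenvalues other than the simple eigenvalue $1$ of the constant function), and the relaxation time is $t_{\mathrm{rel}}=\mathrm{gap}^{-1}$. *)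

(* Defs.v *)
From HB Require Import structures.
From mathcomp Require Import all_boot all_order all_algebra.
From mathcomp Require Import boolp classical_sets reals.

Set Implicit Arguments.
Unset Strict Implicit.
Unset Printing Implicit Defensive.

Import Order.TTheory GRing.Theory Num.Theory.

Local Open Scope classical_set_scope.
Local Open Scope ring_scope.

(* A kernel on {0, ..., n} is a matrix P : 'M[R]_n.+1 with
   P x y the probability of moving from x to y; measures are row vectors. *)

Definition transition_kernel (R : realType) (n : nat) (P : 'M[R]_n.+1) : Prop :=
  (forall x y, 0 <= P x y) /\ (forall x, \sum_y P x y = 1).

Definition birth_and_death (R : realType) (n : nat) (P : 'M[R]_n.+1) : Prop :=
  transition_kernel P /\
  forall x y : 'I_n.+1, (1 < `|(x : nat)%:Z - (y : nat)%:Z|)%N -> P x y = 0.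

Definition lazy_chain (R : realType) (n : nat) (P : 'M[R]_n.+1) : Prop :=
  forall x, 2^-1 <= P x x.

Definition irreducible_chain (R : realType) (n : nat) (P : 'M[R]_n.+1) : Prop :=
  forall x y, exists t : nat, 0 < (P ^+ t) x y.

Definition stationary_distribution (R : realType) (n : nat)
    (P : 'M[R]_n.+1) (pi : 'rV[R]_n.+1) : Prop :=
  [/\ forall x, 0 <= pi 0 x, \sum_x pi 0 x = 1 & pi *m P = pi].

Definition tv_dist (R : realType) (n : nat) (mu nu : 'rV[R]_n.+1) : R :=
  2^-1 * \sum_x `|mu 0 x - nu 0 x|.

(* The default 0 of the maximum is harmless: distances are nonnegative. *)
Definition worst_dist (R : realType) (n : nat)
    (P : 'M[R]_n.+1) (pi : 'rV[R]_n.+1) (t : nat) : R :=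
  \big[Num.max/0]_(x < n.+1) tv_dist (row x (P ^+ t)) pi.

(* For eps > 0 and a lazy irreducible chain, the second branch is never used,
   since then worst_dist tends to 0. *)
Definition tmix (R : realType) (n : nat)
    (P : 'M[R]_n.+1) (pi : 'rV[R]_n.+1) (eps : R) : nat :=
  match pselect (exists t, worst_dist P pi t <= eps) with
  | left ex_t => ex_minn ex_t
  | right _ => 0%N
  end.

(* P acts on functions f by P f, whereas eigenvalue refers to the action on row
   vectors, hence the transpose. A birth-and-death chain is reversible when
   irreducible, so its eigenvalues are all real; the eigenvalue 1 of the constant
   function is then simple, so the nontrivial eigenvalues are those other than 1.
   The set below is finite, and nonempty for n >= 1, so that sup is a maximum. *)
Definition second_eigenvalue (R : realType) (n : nat) (P : 'M[R]_n.+1) : R :=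
  sup [set `|a| | a in [set a : R | eigenvalue P^T a && (a != 1)]].

Definition gap (R : realType) (n : nat) (P : 'M[R]_n.+1) : R :=
  1 - second_eigenvalue P.

Definition trel (R : realType) (n : nat) (P : 'M[R]_n.+1) : R := (gap P)^-1.

(* Main.v *)
(* Let h_l(x) be the mean hitting time of l from x, and s = sqrt(trel tmix(1/4)).
   A birth-and-death chain satisfies h_l(0) = sum_(k < l) pi[0, k] / c_k with
   c_k = pi(k) P(k, k+1), and the variance of the hitting time of l from 0 is at
   most a constant times the sum over k < l of r_k pi[0, k]^2 / c_k, where
   r_k = sum_(k <= i < l) 1 / c_i.  The Poincare inequality for the potential of
   the unit current from [0, j] to [l, n] gives pi[0, j] pi[l, n] r_j <= 2 trel.
   Hence, if pi[l, n] >= delta, the variance is O(trel h_l(0)), and between the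
   delta and 1 - delta quantiles of pi the mean hitting time from 0 increases by
   only O(trel) = O(s).
   The law of the chain from 0 is nearly singular to pi before it reaches the
   delta quantile; after it has hit the 1 - delta quantile it is stochastically to
   the right of pi, up to delta.  So Chebyshev's inequality confines the mixing of
   the chain from 0 to a window of width O(s), and the reversed chain treats the
   start at n.  Laziness makes P^t totally positive of order 2, so total variation
   between rows is attained on initial segments and the endpoints are the worst
   starting points. *)

Require Import Defs.
From HB Require Import structures.
From mathcomp Require Import all_boot all_order all_algebra.
From mathcomp Require Import boolp classical_sets reals.
From mathcomp Require Import zify ring lra.

Set Implicit Arguments.
Unset Strict Implicit.
Unset Printing Implicit Defensive.

Import Order.TTheory GRing.Theory Num.Theory.

Local Open Scope ring_scope.

(** * Total positivity of order 2 and monotonicity of distribution functions *)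

Section TotalPositivity.
Variables (R : realType) (n : nat).
Implicit Types (A B P : 'M[R]_n.+1) (t k : nat).

Lemma transition_kernelX P t : transition_kernel P -> transition_kernel (P ^+ t).
Proof.
move=> [P0 P1]; elim: t => [|t [Q0 Q1]].
  split=> [x y|x]; first by rewrite expr0 mxE ler0n.
  rewrite expr0 (bigD1 x) //= mxE eqxx big1 ?addr0 // => y /negPf neq_yx.
  by rewrite mxE eq_sym neq_yx.
split=> [x y|x]; first by rewrite exprS mxE sumr_ge0 // => z _; rewrite mulr_ge0.
rewrite exprS; under eq_bigr do rewrite mxE.
rewrite exchange_big /= -[RHS](P1 x); apply: eq_bigr => y _.
by rewrite -mulr_sumr Q1 mulr1.
Qed.

Definition tp2 A := forall x y z w : 'I_n.+1,
  (x <= y)%N -> (z <= w)%N -> A x w * A y z <= A x z * A y w.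

(* Cauchy-Binet for 2 x 2 minors, with the sum over pairs symmetrized. *)
Lemma tp2_mul A B : tp2 A -> tp2 B -> tp2 (A *m B).
Proof.
move=> tpA tpB x y z w le_xy le_zw; rewrite -subr_ge0 !mxE.
pose F u v := A x u * A y v * (B u z * B v w - B u w * B v z).
have E : (\sum_u A x u * B u z) * (\sum_v A y v * B v w) -
         (\sum_u A x u * B u w) * (\sum_v A y v * B v z) =
         \sum_u \sum_v F u v.
  rewrite !big_distrlr /= -sumrB; apply: eq_bigr => u _.
  by rewrite -sumrB; apply: eq_bigr => v _; rewrite /F; ring.
rewrite E -(pmulr_rge0 _ (ltr0n R 2)) mulr_natl mulr2n.
rewrite {2}exchange_big -big_split sumr_ge0 //= => u _.
rewrite -big_split sumr_ge0 //= => v _.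
have -> : F u v + F v u =
    (A x u * A y v - A x v * A y u) * (B u z * B v w - B u w * B v z).
  by rewrite /F; ring.
have [le_uv|/ltnW le_vu] := leqP u v.
  by rewrite mulr_ge0 // subr_ge0; [exact: tpA | exact: tpB].
rewrite -mulrNN mulr_ge0 // oppr_ge0 subr_le0; first exact: tpA.
by rewrite mulrC [leRHS]mulrC; exact: tpB.
Qed.

(** For x < y and z < w the product [P x w * P y z] can be nonzero only if z = x and w = y; laziness
    then gives entries at least 1/2 on the diagonal and at most 1/2 off it. *)
Lemma tp2_lazy_birth_and_death P :
  birth_and_death P -> lazy_chain P -> tp2 P.
Proof.
move=> [[P0 P1] Ptri] Plazy x y z w le_xy le_zw.
have off_diag u v : u != v -> P u v <= 2^-1.
  move=> neq_uv; have := P1 u; rewrite (bigD1 u) //= (bigD1 v) 1?eq_sym //=.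
  have := Plazy u; have : 0 <= \sum_(i | (i != u) && (i != v)) P u i by exact: sumr_ge0.
  by lra.
have [eq_xy|neq_xy] := eqVneq x y; first by rewrite eq_xy mulrC.
have [eq_zw|neq_zw] := eqVneq z w; first by rewrite eq_zw mulrC.
have {}neq_xy : (x != y :> nat)%N by [].
have {}neq_zw : (z != w :> nat)%N by [].
have [lt1|le1] := ltnP 1 `|(x : nat)%:Z - (w : nat)%:Z|%N.
  by rewrite (Ptri _ _ lt1) mul0r mulr_ge0.
have [lt2|le2] := ltnP 1 `|(y : nat)%:Z - (z : nat)%:Z|%N.
  by rewrite (Ptri _ _ lt2) mulr0 mulr_ge0.
have -> : z = x by apply: val_inj => /=; lia.
have -> : w = y by apply: val_inj => /=; lia.
have neq : x != y by [].
apply: (@le_trans _ _ (2^-1 * 2^-1)); first by rewrite ler_pM // off_diag // eq_sym.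
by rewrite ler_pM ?invr_ge0.
Qed.

Lemma tp2X P t : tp2 P -> tp2 (P ^+ t).
Proof.
move=> tpP; elim: t => [|t IHt]; last by rewrite exprS; exact: tp2_mul.
move=> x y z w le_xy le_zw; rewrite expr0 !mxE -!natrM ler_nat.
case: eqP => [eq_xw|] //; case: eqP => [eq_yz|] //; rewrite ?muln0 //.
move: le_xy le_zw; rewrite eq_xw -eq_yz => le_wy le_yw.
have -> : w = y by apply: val_inj => /=; lia.
by rewrite eqxx.
Qed.

Definition cdf P t (x : 'I_n.+1) k := \sum_(z < n.+1 | (z < k)%N) (P ^+ t) x z.

Lemma cdf_ge0 P t x k : transition_kernel P -> 0 <= cdf P t x k.
Proof. by move=> /(transition_kernelX t)[Q0 _]; exact: sumr_ge0. Qed.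

Lemma cdf_le1 P t x k : transition_kernel P -> cdf P t x k <= 1.
Proof.
move=> /(transition_kernelX t)[Q0 Q1]; rewrite -(Q1 x) /cdf big_mkcond /=.
by apply: ler_sum => z _; case: ifP.
Qed.

Lemma cdf0 P x k : cdf P 0 x k = (x < k)%N%:R.
Proof.
rewrite /cdf big_mkcond (bigD1 x) //= big1 ?addr0 ?expr0 ?mxE ?eqxx.
  by case: ltnP.
by move=> z /negPf nzx; rewrite mxE eq_sym nzx; case: ifP.
Qed.

Lemma cdfS P t x k : cdf P t.+1 x k = \sum_y P x y * cdf P t y k.
Proof.
rewrite /cdf exprS; under eq_bigr do rewrite mxE.
by rewrite exchange_big; apply: eq_bigr => y _; rewrite mulr_sumr.
Qed.

(* Summing the 2 x 2 minors over z < k <= w. *)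
Lemma cdf_anti P t (x y : 'I_n.+1) k : transition_kernel P -> tp2 P ->
  (x <= y)%N -> cdf P t y k <= cdf P t x k.
Proof.
move=> kerP /(@tp2X _ t) tpQ le_xy; have [_ Q1] := transition_kernelX t kerP.
pose tail x := \sum_(w < n.+1 | ~~ (w < k)%N) (P ^+ t) x w.
have Qsplit u : cdf P t u k + tail u = 1.
  by rewrite -(Q1 u) (bigID (fun z : 'I__ => (z < k)%N)).
suff: tail x * cdf P t y k <= cdf P t x k * tail y.
  have -> : tail x = 1 - cdf P t x k by rewrite -(Qsplit x) addrC addKr.
  have -> : tail y = 1 - cdf P t y k by rewrite -(Qsplit y) addrC addKr.
  by lra.
rewrite mulrC [leRHS]mulrC /cdf /tail !big_distrlr /= exchange_big /=.
apply: ler_sum => w le_kw; apply: ler_sum => z lt_zk.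
rewrite mulrC [leRHS]mulrC; apply: tpQ => //.
by rewrite ltnW // (leq_trans lt_zk) // leqNgt.
Qed.

(* By the monotone likelihood ratio property, P^t(x,.) - P^t(y,.) is
   nonnegative on an initial segment and nonpositive after it. *)
Lemma event_le_threshold P t (x y : 'I_n.+1) (A : pred 'I_n.+1) :
  transition_kernel P -> tp2 P -> (x <= y)%N ->
  exists k, \sum_(z | A z) ((P ^+ t) x z - (P ^+ t) y z) <= cdf P t x k - cdf P t y k.
Proof.
move=> /(transition_kernelX t)[Q0 _] /(@tp2X _ t) tpQ le_xy.
set Q := P ^+ t in Q0 tpQ *.
have [k Hk] : exists k, forall z : 'I_n.+1,
    if (z < k)%N then Q y z <= Q x z else Q x z <= Q y z.
  have [/existsP[w0 w0P]|] := boolP [exists w, Q y w < Q x w]; last first.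
    rewrite negb_exists => /forallP Hno; exists 0%N => z.
    by rewrite ltn0 leNgt Hno.
  case: (@arg_maxnP _ w0 (fun w => Q y w < Q x w) val w0P) => w lt_w w_max.
  exists w.+1 => z; rewrite ltnS; case: leqP => [le_zw|lt_wz].
    rewrite leNgt; apply/negP => lt_z; have := tpQ _ _ _ _ le_xy le_zw.
    rewrite leNgt => /negP; apply; apply: (@le_lt_trans _ _ (Q y z * Q y w)).
      by rewrite ler_wpM2r // ltW.
    by rewrite mulrC ltr_pM2r // (le_lt_trans (Q0 x z)).
  by rewrite leNgt; apply/negP => /w_max /=; rewrite leqNgt lt_wz.
exists k; rewrite /cdf -sumrB big_mkcond [leRHS]big_mkcond /=.
apply: ler_sum => z _; have := Hk z.
by case: ifP; case: ifP => // _ _; rewrite ?subr_ge0 ?subr_le0.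
Qed.

End TotalPositivity.

(** * Detailed balance, conductances and the divergence form of the generator *)

Section Reversible.
Variables (R : realType) (n : nat).
Implicit Types (P : 'M[R]_n.+1) (pi : 'rV[R]_n.+1) (t k : nat).

Definition mass pi k := \sum_(x < n.+1 | (x < k)%N) pi 0 x.

(** Sums over ordinals of prescribed value define the conductance between k and k + 1 for every
    natural k, with value 0 from [n] on. *)
Definition edge P pi k :=
  \sum_(x < n.+1 | x == k :> nat) \sum_(y < n.+1 | y == k.+1 :> nat) pi 0 x * P x y.

(** Positive conductances stand for irreducibility and detailed balance for stationarity; in this
    form the hypotheses pass directly to the chain read from right to left. *)
Record reversible_bd P pi : Prop := ReversibleBD {
  rbd_bd : birth_and_death P;
  rbd_lazy : lazy_chain P;
  rbd_gt0 : forall x, 0 < pi 0 x;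
  rbd_sum1 : \sum_x pi 0 x = 1;
  rbd_balance : forall x y, pi 0 x * P x y = pi 0 y * P y x;
  rbd_edge : forall k, (k < n)%N -> 0 < edge P pi k }.

Lemma edgeE P pi (x y : 'I_n.+1) : y = x.+1 :> nat -> edge P pi x = pi 0 x * P x y.
Proof.
move=> yE; rewrite /edge (big_pred1 x) => [|z]; last by [].
by rewrite (big_pred1 y) // => z; rewrite -yE.
Qed.

Lemma edge_out P pi k : (n <= k)%N -> edge P pi k = 0.
Proof.
move=> le_nk; rewrite /edge big1 // => x _; rewrite big_pred0 // => y.
by apply/negbTE; rewrite neq_ltn (leq_trans (ltn_ord y)).
Qed.

(** Adding the flow inside [0, k] to either side gives pi[0, k]: by the row sums of [P] on the left,
    by stationarity on the right. *)
Lemma stationary_flow P pi k : transition_kernel P -> pi *m P = pi ->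
  \sum_(x < n.+1 | (x <= k)%N) \sum_(y < n.+1 | ~~ (y <= k)%N) pi 0 x * P x y =
  \sum_(x < n.+1 | ~~ (x <= k)%N) \sum_(y < n.+1 | (y <= k)%N) pi 0 x * P x y.
Proof.
move=> [_ P1] statP.
pose a := \sum_(x < n.+1 | (x <= k)%N) \sum_(y < n.+1 | (y <= k)%N) pi 0 x * P x y.
apply: (@addrI _ a); transitivity (\sum_(x < n.+1 | (x <= k)%N) pi 0 x).
  rewrite -big_split /=; apply: eq_bigr => x _.
  rewrite -[RHS]mulr1 -[in RHS](P1 x) mulr_sumr.
  by rewrite [RHS](bigID (fun y : 'I_n.+1 => (y <= k)%N)).
rewrite /a [in RHS]exchange_big [X in _ = _ + X]exchange_big /= -big_split /=.
apply: eq_bigr => y _; rewrite -[LHS](congr1 (fun v : 'rV_n.+1 => v 0 y) statP) mxE.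
by rewrite [LHS](bigID (fun x : 'I_n.+1 => (x <= k)%N)).
Qed.

(** Only the edge between x and x + 1 crosses the cut after x, so equality of the two flows is
    detailed balance. *)
Lemma stationary_balance P pi : birth_and_death P -> pi *m P = pi ->
  forall x y, pi 0 x * P x y = pi 0 y * P y x.
Proof.
move=> [kerP Ptri] statP.
have step (x y : 'I_n.+1) : y = x.+1 :> nat -> pi 0 x * P x y = pi 0 y * P y x.
  move=> yE; have := stationary_flow x kerP statP.
  rewrite (bigD1 x) //= (bigD1 y) /= -?ltnNge ?yE //.
  rewrite [X in _ + X + _]big1 ?addr0; last first.
    move=> z /andP[]; rewrite -ltnNge -val_eqE /= => lt_xz nzy.
    by rewrite Ptri ?mulr0 //; move: nzy; rewrite yE; lia.
  rewrite [X in _ + X = _]big1 ?addr0; last first.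
    move=> z /andP[le_zx]; rewrite -val_eqE /= => nzx; rewrite big1 // => w.
    by rewrite -ltnNge => lt_xw; rewrite Ptri ?mulr0 //; lia.
  move=> ->; rewrite (bigD1 y) /= -?ltnNge ?yE // (bigD1 x) //=.
  rewrite [X in _ + X + _]big1 ?addr0; last first.
    move=> z /andP[le_zx]; rewrite -val_eqE /= => nzx.
    by rewrite Ptri ?mulr0 //; rewrite yE; lia.
  rewrite [X in _ + X]big1 ?addr0 // => z /andP[]; rewrite -ltnNge -val_eqE /= yE => lt_xz nzy.
  by rewrite big1 // => w le_wx; rewrite Ptri ?mulr0 //; lia.
move=> x y; have [->//|neq_xy] := eqVneq x y.
have {}neq_xy : x != y :> nat by [].
have [far|near] := ltnP 1 `|(x : nat)%:Z - (y : nat)%:Z|%N.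
  by rewrite !Ptri ?mulr0 //; lia.
have [lt_xy|le_yx] := ltnP x y; first by apply: step; lia.
by apply/esym/step; lia.
Qed.

Lemma stationaryX P pi t : pi *m P = pi -> pi *m P ^+ t = pi.
Proof.
move=> statP; elim: t => [|t IHt]; first by rewrite expr0 mulmx1.
by rewrite exprS mulmxA statP.
Qed.

(** With zero conductance after k, no power of [P] would lead from [0, k] to the right of k. *)
Lemma irreducible_edge P pi k : birth_and_death P -> irreducible_chain P ->
  (forall x, 0 < pi 0 x) -> (k < n)%N -> 0 < edge P pi k.
Proof.
move=> [[P0 _] Ptri] irrP pi0 lt_kn.
have kP : (k < n.+1)%N by exact: ltnW.
pose x0 : 'I_n.+1 := Ordinal kP; pose y0 : 'I_n.+1 := Ordinal (lt_kn : (k.+1 < n.+1)%N).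
rewrite (@edgeE P pi x0 y0) // mulr_gt0 // lt_neqAle P0 andbT eq_sym.
apply/eqP => Pxy0.
suff stuck t (x y : 'I_n.+1) : (x <= k)%N -> (k < y)%N -> (P ^+ t) x y = 0.
  by have [t] := irrP x0 y0; rewrite stuck // ltxx.
elim: t x y => [|t IHt] x y le_xk lt_ky.
  by rewrite expr0 mxE -val_eqE ltn_eqF // (leq_ltn_trans le_xk).
rewrite exprS mxE big1 // => z _; have [le_zk|lt_kz] := leqP z k.
  by rewrite IHt ?mulr0.
have [far|near] := ltnP 1 `|(x : nat)%:Z - (z : nat)%:Z|%N.
  by rewrite Ptri ?mul0r.
have -> : x = x0 by apply: val_inj => /=; lia.
have -> : z = y0 by apply: val_inj => /=; lia.
by rewrite Pxy0 mul0r.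
Qed.

Lemma irreducible_stationary_gt0 P pi : transition_kernel P -> irreducible_chain P ->
  stationary_distribution P pi -> forall x, 0 < pi 0 x.
Proof.
move=> kerP irrP [pi0 pi1 statP] y.
have [x pix] : exists x, 0 < pi 0 x.
  apply/existsP; apply: contraT; rewrite negb_exists => /forallP pi_le0.
  have : \sum_x pi 0 x <= 0 :> R by apply: sumr_le0 => x _; rewrite leNgt.
  by rewrite pi1 ler10.
have [t Pxy] := irrP x y; have [Q0 _] := transition_kernelX t kerP.
rewrite -(stationaryX t statP) mxE (bigD1 x) //=.
by rewrite ltr_pwDl ?mulr_gt0 // sumr_ge0 // => z _; rewrite mulr_ge0.
Qed.

Lemma irreducible_reversible_bd P pi :
  birth_and_death P -> lazy_chain P -> irreducible_chain P ->
  stationary_distribution P pi -> reversible_bd P pi.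
Proof.
move=> bdP lazyP irrP statP; have [_ pi1 piP] := statP.
have pi0 := irreducible_stationary_gt0 (proj1 bdP) irrP statP.
split=> //; first exact: stationary_balance.
by move=> k; exact: irreducible_edge.
Qed.

Lemma rbd_stationary P pi : reversible_bd P pi -> pi *m P = pi.
Proof.
move=> [[[_ P1] _] _ _ _ bal _]; apply/rowP => y; rewrite mxE.
by under eq_bigr do rewrite bal; rewrite -mulr_sumr P1 mulr1.
Qed.

Lemma mass_ge0 P pi k : reversible_bd P pi -> 0 <= mass pi k.
Proof. by case=> _ _ pi0 _ _ _; apply: sumr_ge0 => x _; exact: ltW. Qed.

Lemma mass0 pi : mass pi 0 = 0.
Proof. by rewrite /mass big_pred0. Qed.

Lemma mass_homo P pi j k : reversible_bd P pi -> (j <= k)%N -> mass pi j <= mass pi k.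
Proof.
case=> _ _ pi0 _ _ _ le_jk; rewrite /mass big_mkcond [leRHS]big_mkcond /=.
apply: ler_sum => x _; case: ifP => [lt_xj|_]; first by rewrite (leq_trans lt_xj).
by case: ifP => // _; exact: ltW.
Qed.

Lemma massT P pi : reversible_bd P pi -> mass pi n.+1 = 1.
Proof. by case=> _ _ _ <- _ _; apply: eq_bigl => x; rewrite ltn_ord. Qed.

Lemma mass_le1 P pi k : reversible_bd P pi -> mass pi k <= 1.
Proof.
move=> H; have [le_kn|lt_nk] := leqP k n.+1.
  by rewrite -(massT H) (mass_homo H).
rewrite -(massT H) /mass big_mkcond [leRHS]big_mkcond /=.
by apply: ler_sum => x _; rewrite ltn_ord (ltn_trans (ltn_ord x)).
Qed.

(* The generator in divergence form; at x = 0 the second flux vanishes since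
   0.-1 = 0, at x = n the first one since edge n = 0. *)
Lemma generatorE P pi (f : nat -> R) (x : 'I_n.+1) : reversible_bd P pi ->
  pi 0 x * \sum_y P x y * (f y - f x) =
    edge P pi x * (f x.+1 - f x) - edge P pi x.-1 * (f x - f x.-1).
Proof.
move=> H; have [_ Ptri] := rbd_bd H.
have -> : \sum_y P x y * (f y - f x) =
    \sum_(y < n.+1 | y == x.+1 :> nat) P x y * (f x.+1 - f x) +
    \sum_(y < n.+1 | y.+1 == x :> nat) P x y * (f x.-1 - f x).
  rewrite [X in X + _]big_mkcond [X in _ + X]big_mkcond -big_split /=.
  apply: eq_bigr => y _; have [yE|ny] := eqVneq (y : nat) x.+1.
    by rewrite yE (_ : (x.+2 == x)%N = false) ?addr0 //; lia.
  have [xE|nx] := eqVneq (y.+1 : nat) x; first by rewrite -xE add0r.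
  have [->|nxy] := eqVneq y x; first by rewrite subrr mulr0 addr0.
  by rewrite Ptri ?mul0r ?addr0 //; move: nxy nx ny; rewrite -val_eqE /=; lia.
rewrite mulrDr -!mulr_suml !mulrA; congr (_ + _).
  by congr (_ * _); rewrite mulr_sumr /edge [RHS](big_pred1 x).
rewrite -[f x.-1 - f x]opprB mulrN; congr (- _); case: x => -[|m] lt_mn /=.
  by rewrite subrr !mulr0.
congr (_ * _); have lt_mn' : (m < n.+1)%N by exact: ltnW.
rewrite (@edgeE P pi (Ordinal lt_mn') (Ordinal lt_mn)) // rbd_balance //.
by rewrite (big_pred1 (Ordinal lt_mn')).
Qed.

Lemma square_generatorE P pi (f : nat -> R) (x : 'I_n.+1) : reversible_bd P pi ->
  pi 0 x * \sum_y P x y * (f y - f x) ^+ 2 =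
    edge P pi x * (f x.+1 - f x) ^+ 2 + edge P pi x.-1 * (f x - f x.-1) ^+ 2.
Proof.
move=> H; have := generatorE (fun k => (f k - f x) ^+ 2) x H.
by rewrite subrr expr0n /=; under eq_bigr do rewrite subr0; move=> ->; ring.
Qed.

End Reversible.

(** * Hitting times: means, variance bounds and Chebyshev estimates *)

Section HittingTimes.
Variables (R : realType) (n : nat) (P : 'M[R]_n.+1) (pi : 'rV[R]_n.+1).
Hypothesis rbd : reversible_bd P pi.
Implicit Types (t k l : nat) (g : 'I_n.+1 -> R).

Let kerP : transition_kernel P := proj1 (rbd_bd rbd).
Let P0 : forall x y, 0 <= P x y := proj1 kerP.
Let P1 : forall x, \sum_y P x y = 1 := proj2 kerP.
Let tpP : tp2 P := tp2_lazy_birth_and_death (rbd_bd rbd) (rbd_lazy rbd).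

Lemma edge_ge0 k : 0 <= edge P pi k.
Proof.
have [lt_kn|le_nk] := ltnP k n; first by rewrite ltW // (rbd_edge rbd).
by rewrite edge_out.
Qed.

(* [pot l g x] is the expected sum of [g] along the chain from [x] until it
   hits [l]: the Green function of the chain killed at [l] is explicit. *)
Definition pot l g (x : nat) : R :=
  \sum_(x <= k < l) (\sum_(y < n.+1 | (y < k.+1)%N) pi 0 y * g y) / edge P pi k.

Lemma pot_ge0 l g x : (forall y, 0 <= g y) -> 0 <= pot l g x.
Proof.
move=> g0; apply: sumr_ge0 => k _; rewrite divr_ge0 ?edge_ge0 //.
by apply: sumr_ge0 => y _; rewrite mulr_ge0 // ltW // (rbd_gt0 rbd).
Qed.

Lemma pot_out l g x : (l <= x)%N -> pot l g x = 0.
Proof. by move=> le_lx; rewrite /pot big_geq. Qed.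

Lemma pot_anti l g (x y : nat) :
  (forall y, 0 <= g y) -> (x <= y)%N -> pot l g y <= pot l g x.
Proof.
move=> g0 le_xy; have [le_yl|/ltnW le_ly] := leqP y l; last first.
  by rewrite [leLHS]pot_out // pot_ge0.
rewrite /pot [leRHS](big_cat_nat le_xy le_yl) /= lerDr.
apply: sumr_ge0 => k _; rewrite divr_ge0 ?edge_ge0 //.
by apply: sumr_ge0 => z _; rewrite mulr_ge0 // ltW // (rbd_gt0 rbd).
Qed.

(** This is the Poisson equation of the chain killed at [l]: the flux of [pot l g] through the edge
    k is minus the integral of [g] over [0, k], and the generator is the divergence of the flux. *)
Lemma pot_mean l g (x : 'I_n.+1) : (l <= n)%N -> (x < l)%N ->
  \sum_y P x y * pot l g y = pot l g x - g x.
Proof.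
move=> le_ln lt_xl; pose W k := \sum_(y < n.+1 | (y < k)%N) pi 0 y * g y.
have flux k : (k < l)%N -> edge P pi k * (pot l g k.+1 - pot l g k) = - W k.+1.
  move=> lt_kl; rewrite /pot (big_ltn lt_kl) opprD addrC subrK mulrN mulrCA.
  by rewrite divff ?mulr1 // gt_eqF // (rbd_edge rbd) // (leq_trans lt_kl).
have WS : W x.+1 = W x + pi 0 x * g x.
  rewrite /W (bigD1 x) //= addrC; congr (_ + _); apply: eq_bigl => y.
  by rewrite -val_eqE /=; lia.
have flux' : edge P pi x.-1 * (pot l g x - pot l g x.-1) = - W x.
  case: (x : nat) lt_xl => [_|m lt_ml]; last by rewrite flux // ltnW.
  by rewrite subrr mulr0 /W big_pred0 ?oppr0.
have pix : pi 0 x != 0 by rewrite gt_eqF // (rbd_gt0 rbd).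
have -> : \sum_y P x y * pot l g y =
    pot l g x + \sum_y P x y * (pot l g y - pot l g x).
  under [in RHS]eq_bigr do rewrite mulrBr.
  by rewrite sumrB -mulr_suml P1 mul1r addrC subrK.
congr (_ + _); apply: (mulfI pix); rewrite generatorE // flux // flux' WS.
by ring.
Qed.

Definition hit_mean l := pot l (fun=> 1).

(* Dominates the variance of the hitting time of [l], the conditional
   variance of [hit_mean] along one step being replaced by a second moment. *)
Definition hit_var l :=
  pot l (fun x => \sum_y P x y * (hit_mean l y - hit_mean l x) ^+ 2).

Lemma hit_mean_ge0 l x : 0 <= hit_mean l x.
Proof. by apply: pot_ge0 => ?; exact: ler01. Qed.

Lemma hit_mean_anti l (x y : nat) : (x <= y)%N -> hit_mean l y <= hit_mean l x.
Proof. by apply: pot_anti => ?; exact: ler01. Qed.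

Lemma hit_meanE l x :
  hit_mean l x = \sum_(x <= k < l) mass pi k.+1 / edge P pi k.
Proof.
by apply: eq_bigr => k _; congr (_ / _); apply: eq_bigr => y _; rewrite mulr1.
Qed.

Lemma hit_var_ge0 l x : 0 <= hit_var l x.
Proof.
by apply: pot_ge0 => y; apply: sumr_ge0 => z _; rewrite mulr_ge0 ?sqr_ge0.
Qed.

(** The second moment [G] lost by [hit_var] in one step is regained by the square, while the mean
    falls by 1. A slack of 1 remains because [G] is not centred at the conditional mean. *)
Lemma hit_step l (x : 'I_n.+1) s : (l <= n)%N -> (x < l)%N ->
  \sum_y P x y * (hit_var l y + (hit_mean l y - s) ^+ 2) <=
  hit_var l x + (hit_mean l x - 1 - s) ^+ 2.
Proof.
move=> le_ln lt_xl; set h := hit_mean l.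
pose G := \sum_y P x y * (h y - h x) ^+ 2.
have -> : \sum_y P x y * (hit_var l y + (h y - s) ^+ 2) =
    \sum_y P x y * hit_var l y + G + 2 * (h x - s) * (\sum_y P x y * h y) +
    (s ^+ 2 - h x ^+ 2) * \sum_y P x y.
  rewrite /G !mulr_sumr -!big_split /=; apply: eq_bigr => y _.
  by ring.
rewrite /h /hit_mean !pot_mean // P1 -/(hit_mean l) -/h -/G.
rewrite -[pot l _ x]/(hit_var l x); lra.
Qed.

(* Chebyshev for the hitting time of [l], before which the chain is left of
   [l] and after which it is stochastically to the right of the stationary
   chain conditioned on [0, l]. *)
Lemma upper_tail l k t : (l <= n)%N -> hit_mean l 0 <= t%:R ->
  (cdf P t 0 k - mass pi k - (1 - mass pi l.+1)) * (t%:R - hit_mean l 0) ^+ 2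
    <= hit_var l 0.
Proof.
move=> le_ln le_ht.
have at_l s (x : 'I_n.+1) : (l <= x)%N -> cdf P s x k <= mass pi k + (1 - mass pi l.+1).
  move=> le_lx.
  have -> : mass pi k = \sum_y pi 0 y * cdf P s y k.
    rewrite /mass -{1}(stationaryX s (rbd_stationary rbd)).
    under eq_bigr do rewrite mxE.
    by rewrite exchange_big; apply: eq_bigr => y _; rewrite mulr_sumr.
  have : cdf P s x k * mass pi l.+1 <= \sum_y pi 0 y * cdf P s y k.
    rewrite mulrC mulr_suml big_mkcond /=; apply: ler_sum => y _.
    case: ifP => [lt_yl|_]; last by rewrite mulr_ge0 ?cdf_ge0 // ltW // (rbd_gt0 rbd).
    rewrite ler_wpM2l //; first by rewrite ltW // (rbd_gt0 rbd).
    by rewrite cdf_anti // -ltnS (leq_trans lt_yl).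
  have := cdf_le1 s x k kerP; have := mass_le1 l.+1 rbd; have := cdf_ge0 s x k kerP.
  set c := cdf _ _ _ _; set m := mass _ _ => c0 m1 c1.
  have : 0 <= (1 - c) * (1 - m) by rewrite mulr_ge0 // subr_ge0.
  by lra.
set C := mass pi k + (1 - mass pi l.+1) in at_l.
have C0 : 0 <= C by rewrite addr_ge0 ?(mass_ge0 _ rbd) // subr_ge0 (mass_le1 _ rbd).
set a := t%:R - hit_mean l 0; have a0 : 0 <= a by rewrite subr_ge0.
(* The shift by [a] cancels the square at x = 0 and s = t. The induction needs every starting point;
   from [l] on, [at_l] makes the left side nonpositive. *)
have key s (x : 'I_n.+1) :
    (cdf P s x k - C) * a ^+ 2 <= hit_var l x + (hit_mean l x - s%:R + a) ^+ 2.
  elim: s x => [|s IHs] x; have [lt_xl|le_lx] := ltnP x l; try by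
      apply: (@le_trans _ _ 0); [rewrite mulr_le0_ge0 ?sqr_ge0 // subr_le0 at_l|
        rewrite addr_ge0 ?hit_var_ge0 ?sqr_ge0].
    apply: (@le_trans _ _ (a ^+ 2)).
      rewrite ler_piMl ?sqr_ge0 //; have := cdf_le1 0 x k kerP; lra.
    apply: (@le_trans _ _ ((hit_mean l x - 0 + a) ^+ 2)).
      by rewrite subr0 ler_sqr ?nnegrE ?(addr_ge0 (hit_mean_ge0 _ _) a0) // lerDr hit_mean_ge0.
    by rewrite lerDr hit_var_ge0.
  have -> : (cdf P s.+1 x k - C) * a ^+ 2 =
      \sum_y P x y * ((cdf P s y k - C) * a ^+ 2).
    rewrite cdfS -[in LHS](mulr1 C) -(P1 x) mulr_sumr -sumrB mulr_suml.
    by apply: eq_bigr => y _; ring.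
  apply: le_trans (_ : \sum_y P x y * (hit_var l y + (hit_mean l y - (s%:R - a)) ^+ 2) <= _).
    by apply: ler_sum => y _; rewrite ler_wpM2l // opprB addrA addrAC.
  apply: le_trans (hit_step _ le_ln lt_xl) _.
  by rewrite -natr1; lra.
have := key t 0; rewrite /C opprD addrA [X in _ <= _ + X](_ : _ = 0) ?addr0 //.
by rewrite /a /=; ring.
Qed.

(** Chebyshev in the other direction: to be at or beyond [l] at time [t], the chain must have hit
    [l] by then. The second alternative covers times past the mean. *)
Lemma lower_tail l t : (l <= n)%N ->
  (1 - cdf P t 0 l) * (hit_mean l 0 - t%:R) ^+ 2 <= hit_var l 0 \/
  hit_mean l 0 <= t%:R.
Proof.
move=> le_ln; have [|/ltW le_th] := leP (hit_mean l 0) t%:R; [by right | left].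
set a := hit_mean l 0 - t%:R; have a0 : 0 <= a by rewrite subr_ge0.
suff key s (x : 'I_n.+1) :
    (1 - cdf P s x l) * a ^+ 2 <= hit_var l x + (hit_mean l x - s%:R - a) ^+ 2.
  by have := key t 0; rewrite [X in _ <= _ + X](_ : _ = 0) ?addr0 // /a; ring.
elim: s x => [|s IHs] x; have [lt_xl|le_lx] := ltnP x l.
- by rewrite cdf0 lt_xl subrr mul0r addr_ge0 ?hit_var_ge0 ?sqr_ge0.
- rewrite cdf0 ltnNge le_lx subr0 mul1r /hit_mean pot_out // subr0 sub0r sqrrN.
  by rewrite lerDr hit_var_ge0.
- have -> : (1 - cdf P s.+1 x l) * a ^+ 2 =
      \sum_y P x y * ((1 - cdf P s y l) * a ^+ 2).
    rewrite cdfS -[X in X - _](P1 x) -sumrB mulr_suml.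
    by apply: eq_bigr => y _; ring.
  apply: le_trans (_ : \sum_y P x y * (hit_var l y + (hit_mean l y - (s%:R + a)) ^+ 2) <= _).
    by apply: ler_sum => y _; rewrite ler_wpM2l // opprD addrA.
  apply: le_trans (hit_step _ le_ln lt_xl) _.
  by rewrite -natr1; lra.
- apply: (@le_trans _ _ (a ^+ 2)).
    by rewrite ler_piMl ?sqr_ge0 // gerBl cdf_ge0.
  rewrite /hit_mean pot_out // sub0r -opprD sqrrN.
  apply: (@le_trans _ _ ((s.+1%:R + a) ^+ 2)); last by rewrite lerDr hit_var_ge0.
  by rewrite ler_sqr ?nnegrE ?(addr_ge0 (ler0n _ _) a0) // lerDr.
Qed.

(** Stop at time [t]: a chain that has not hit [l] is still left of it, and needs at most
    [hit_mean l 0] more steps on average. *)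
Lemma hit_mean_le l t : (l <= n)%N ->
  hit_mean l 0 <= t%:R + hit_mean l 0 * cdf P t 0 l.
Proof.
move=> le_ln; suff key s (x : 'I_n.+1) :
    hit_mean l x <= s%:R + hit_mean l 0 * cdf P s x l by exact: (key t 0).
elim: s x => [|s IHs] x; have [lt_xl|le_lx] := ltnP x l.
- by rewrite add0r cdf0 lt_xl mulr1 hit_mean_anti.
- by rewrite /hit_mean pot_out // addr_ge0 // mulr_ge0 ?hit_mean_ge0 ?cdf_ge0.
- have : \sum_y P x y * hit_mean l y <= \sum_y P x y * (s%:R + hit_mean l 0 * cdf P s y l).
    by apply: ler_sum => y _; rewrite ler_wpM2l.
  rewrite {1}/hit_mean pot_mean // -/(hit_mean l x) lerBlDr.
  move/le_trans; apply; under eq_bigr do rewrite mulrDr mulrCA.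
  by rewrite big_split /= -mulr_suml P1 mul1r -mulr_sumr -cdfS addrAC natr1.
- by rewrite /hit_mean pot_out // addr_ge0 // mulr_ge0 ?hit_mean_ge0 ?cdf_ge0.
Qed.

End HittingTimes.

(** * Resistances, fluctuations of hitting times and the cutoff window *)

Section Fluctuations.
Variables (R : realType) (n : nat) (P : 'M[R]_n.+1) (pi : 'rV[R]_n.+1).
Hypothesis rbd : reversible_bd P pi.
Implicit Types (t k l : nat) (f : nat -> R).

(** Sums over ordered pairs give twice the variance and twice the Dirichlet form, so [T] is a
    Poincare constant in the usual normalization. *)
Definition poincare T := forall f : 'I_n.+1 -> R,
  \sum_x \sum_y pi 0 x * pi 0 y * (f x - f y) ^+ 2 <=
  T * \sum_x \sum_y pi 0 x * P x y * (f x - f y) ^+ 2.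

(** Each edge is counted from its two endpoints, hence the factor 2. *)
Lemma sum_square_le f m : (m <= n.+1)%N ->
  \sum_(x < n.+1 | (x < m)%N) pi 0 x * \sum_y P x y * (f y - f x) ^+ 2 <=
  2 * \sum_(0 <= k < m) edge P pi k * (f k.+1 - f k) ^+ 2.
Proof.
move=> le_mn; under eq_bigr do rewrite (square_generatorE _ _ rbd).
rewrite big_split /=.
rewrite -(big_ord_widen _ (fun x => edge P pi x * (f x.+1 - f x) ^+ 2) le_mn).
rewrite -(big_ord_widen _ (fun x => edge P pi x.-1 * (f x - f x.-1) ^+ 2) le_mn).
rewrite mulr_natl mulr2n big_mkord lerD2l; case: m {le_mn} => [|m].
  by rewrite !big_ord0.
rewrite big_ord_recl /= subrr expr0n mulr0 add0r big_ord_recr /= lerDl.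
by rewrite mulr_ge0 ?sqr_ge0 ?(edge_ge0 rbd).
Qed.

(* Poincare inequality for the potential of the unit current from [0, j] to [l, n]. *)
Lemma resistance_le T j l : poincare T -> 0 <= T -> (j <= l)%N -> (l <= n)%N ->
  mass pi j.+1 * (1 - mass pi l) * \sum_(j <= k < l) (edge P pi k)^-1 <= 2 * T.
Proof.
move=> poinT T0 le_jl le_ln; set rho := \sum_(j <= k < l) _.
have rho0 : 0 <= rho by apply: sumr_ge0 => k _; rewrite invr_ge0 edge_ge0.
have [->|rho_neq0] := eqVneq rho 0; first by rewrite mulr0 mulr_ge0.
have rho_gt0 : 0 < rho by rewrite lt_neqAle eq_sym rho_neq0.
(* [maxn] freezes [f] at [rho] up to [j], and [f] vanishes from [l] on; each edge in between carries
   energy equal to its resistance. *)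
pose f x := \sum_(maxn x j <= k < l) (edge P pi k)^-1.
have energy : \sum_(0 <= k < n.+1) edge P pi k * (f k.+1 - f k) ^+ 2 = rho.
  have le_ln' : (l <= n.+1)%N by exact: leqW.
  rewrite (big_cat_nat (leq0n j) (leq_trans le_jl le_ln')) /= (big_cat_nat le_jl le_ln') /=.
  rewrite big_nat big1 ?add0r => [|k /andP[_ lt_kj]]; last first.
    by rewrite /f !(maxn_idPr _) // ?subrr ?expr0n ?mulr0 // ltnW.
  rewrite [X in _ + X]big_nat [X in _ + X]big1 ?addr0 => [|k /andP[le_lk _]]; last first.
    by rewrite /f ![\sum_(_ <= _ < _) _]big_geq ?subrr ?expr0n ?mulr0 //; lia.
  apply: eq_big_nat => k /andP[le_jk lt_kl].
  rewrite /f !(maxn_idPl _) ?leqW // (big_ltn lt_kl) opprD addrC subrK sqrrN expr2.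
  rewrite mulVKf // gt_eqF // (rbd_edge rbd) //.
  exact: leq_trans le_ln.
(* After multiplication by [rho], the left side is the part of the double sum over x <= j and y >=
   l, where [f] differs by [rho]. *)
rewrite -(ler_pM2r rho_gt0) -!mulrA -expr2 [leLHS]mulrA [leRHS]mulrA.
apply: le_trans (_ : \sum_(x < n.+1) \sum_(y < n.+1) pi 0 x * pi 0 y * (f x - f y) ^+ 2 <= _).
  have -> : 1 - mass pi l = \sum_(y < n.+1 | ~~ (y < l)%N) pi 0 y.
    rewrite -(rbd_sum1 rbd) (bigID (fun y : 'I_n.+1 => (y < l)%N)) /=.
    by rewrite /mass addrAC subrr add0r.
  have pi_ge0 x := ltW (rbd_gt0 rbd x).
  have term_ge0 (x y : 'I_n.+1) : 0 <= pi 0 x * pi 0 y * (f x - f y) ^+ 2.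
    by rewrite mulr_ge0 ?sqr_ge0 // mulr_ge0.
  rewrite /mass big_distrlr /= mulr_suml big_mkcond /=.
  apply: ler_sum => x _; case: ifP => [le_xj|_]; last exact: sumr_ge0.
  rewrite mulr_suml big_mkcond /=; apply: ler_sum => y _; case: ifP => // le_ly.
  suff -> : rho = f x - f y by [].
  have le_l : (l <= maxn y j)%N by rewrite leq_max leqNgt le_ly.
  by rewrite /f [X in _ - X]big_geq // subr0 (maxn_idPr _).
apply: le_trans (poinT _) _; rewrite -mulrA mulrCA ler_wpM2l //.
rewrite -energy; apply: le_trans (sum_square_le f (leqnn _)).
rewrite le_eqVlt; apply/orP; left; apply/eqP; apply: eq_big => [x|x _].
  by rewrite ltn_ord.
by rewrite mulr_sumr; apply: eq_bigr => y _; rewrite -mulrA -sqrrN opprB.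
Qed.

(* Exchanging the sums, the energy through the edge k is weighted by the
   resistance between k and l, which resistance_le bounds by the mass. *)
Lemma hit_var_le T l (delta : R) : poincare T -> 0 <= T -> 0 < delta ->
  (l <= n)%N -> delta <= 1 - mass pi l ->
  hit_var P pi l 0 <= 4 * T / delta * hit_mean P pi l 0.
Proof.
move=> poinT T0 delta0 le_ln le_delta; set h := hit_mean P pi l.
pose c k := edge P pi k.
have c_gt0 k : (k < l)%N -> 0 < c k.
  by move=> lt_kl; rewrite (rbd_edge rbd) // (leq_trans lt_kl).
have -> : 4 * T / delta * h 0 = \sum_(0 <= j < l) 2 * (2 * T / delta) * (mass pi j.+1 / c j).
  by rewrite -mulr_sumr -hit_meanE -/h; ring.
pose G j := c j * (h j.+1 - h j) ^+ 2.
apply: (@le_trans _ _ (\sum_(0 <= k < l) 2 * (\sum_(0 <= j < k.+1) G j) / c k)).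
  rewrite /hit_var /pot big_nat [leRHS]big_nat; apply: ler_sum => k /andP[_ lt_kl].
  rewrite ler_wpM2r ?invr_ge0 ?(ltW (c_gt0 _ _)) //.
  by apply: sum_square_le; rewrite ltnS (leq_trans (ltnW lt_kl)).
have -> : \sum_(0 <= k < l) 2 * (\sum_(0 <= j < k.+1) G j) / c k =
    \sum_(0 <= j < l) 2 * G j * \sum_(j <= k < l) (c k)^-1.
  transitivity (\sum_(k < l) \sum_(j < l | (j <= k)%N) 2 * G j * (c k)^-1).
    rewrite big_mkord; apply: eq_bigr => k _.
    rewrite big_mkord (big_ord_widen l G) // mulr_sumr mulr_suml.
    by apply: eq_bigl => j; rewrite ltnS.
  rewrite (exchange_big_dep predT) //= big_mkord; apply: eq_bigr => j _.
  by rewrite mulr_sumr (big_nat_widenl _ 0) // big_mkord.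
rewrite big_nat [leRHS]big_nat; apply: ler_sum => j /andP[_ lt_jl].
have hj : h j.+1 - h j = - (mass pi j.+1 / c j).
  by rewrite /h !hit_meanE (big_ltn lt_jl) opprD addrC subrK.
have resj : mass pi j.+1 * \sum_(j <= k < l) (c k)^-1 <= 2 * T / delta.
  rewrite ler_pdivlMr //; apply: le_trans (resistance_le poinT T0 (ltnW lt_jl) le_ln).
  rewrite mulrAC ler_wpM2r ?sumr_ge0 // => [k _|]; first by rewrite invr_ge0 edge_ge0.
  by rewrite ler_wpM2l // (mass_ge0 _ rbd).
(* One factor of the mass is spent on the resistance, the other rebuilds the summand of
   [hit_mean]. *)
have -> : 2 * G j * (\sum_(j <= k < l) (c k)^-1) =
    2 * (mass pi j.+1 * \sum_(j <= k < l) (c k)^-1) * (mass pi j.+1 / c j).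
  have cj : c j != 0 by rewrite gt_eqF ?c_gt0.
  by rewrite /G hj; field.
rewrite ler_wpM2r ?divr_ge0 ?(mass_ge0 _ rbd) ?(ltW (c_gt0 _ _)) //.
by rewrite ler_wpM2l.
Qed.

Lemma quantile (q : R) : 0 < q <= 1 ->
  exists l, [/\ (l <= n)%N, mass pi l < q & q <= mass pi l.+1].
Proof.
case/andP=> q0 q1.
have ex_l : exists l, q <= mass pi l.+1 by exists n; rewrite (massT rbd).
case: (ex_minnP ex_l) => l ql l_min; exists l; split=> //.
  by apply: l_min; rewrite (massT rbd).
case: l {ql} l_min => [|l] l_min; first by rewrite mass0.
by rewrite ltNge; apply/negP => /l_min; rewrite ltnn.
Qed.

(** At time [t0], mass at least 3 [delta] lies at or beyond the [delta] quantile, so the mean time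
    to hit that quantile is at most [t0] + O(s). Moving on to the 1 - [delta] quantile costs O(T) =
    O(s), and Chebyshev then bounds the left tail. The constant 11 is 2 + 4 + 5 for these three
    steps. *)
Lemma cutoff_window_left T (delta : R) t0 t1 t k :
  poincare T -> 0 < T -> T <= 2 * t1%:R -> 0 < delta <= 8^-1 ->
  (forall k, cdf P t1 0 k <= mass pi k + 4^-1) ->
  (forall k, cdf P t0 0 k <= mass pi k + (1 - 4 * delta)) ->
  t0%:R + 11 * Num.sqrt (T * t1%:R) / delta ^+ 2 <= t%:R ->
  cdf P t 0 k <= mass pi k + 2 * delta.
Proof.
move=> poinT T0 le_Tt1 /andP[d0 d8] mix1 mix0.
have t1_gt0 : 0 < t1%:R :> R by lra.
set s := Num.sqrt _ => le_t.
have sE : s ^+ 2 = T * t1%:R by rewrite sqr_sqrtr // mulr_ge0 // ltW.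
have s0 : 0 < s by rewrite sqrtr_gt0 mulr_gt0.
have dI : delta <= 1 by lra.
have [lm [lmn lm_lt lm_ge]] := @quantile delta ltac:(by apply/andP; split; lra).
have [lp [lpn lp_lt lp_ge]] := @quantile (1 - delta) ltac:(by apply/andP; split; lra).
have le_lm_lp : (lm <= lp)%N.
  rewrite leqNgt; apply/negP => /(mass_homo rbd); lra.
pose hm := hit_mean P pi lm 0; pose hp := hit_mean P pi lp 0.
have hm0 : 0 <= hm by exact: hit_mean_ge0.
(* At time [t1] the chain is left of [lm] with probability at most [delta] + 1/4, hence at most
   1/2. *)
have hm_le : hm <= 2 * t1%:R.
  have := hit_mean_le rbd t1 lmn; have := mix1 lm; rewrite -/hm => c_le.
  have : hm * cdf P t1 0 lm <= hm * 2^-1 by rewrite ler_wpM2l //; lra.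
  by lra.
(* The increase of the mean is at most the resistance between [lm] and [lp], and both [0, lm] and
   [lp, n] have mass at least [delta]. *)
have hp_le : hp <= hm + 2 * T / delta ^+ 2.
  have rho_le := resistance_le poinT (ltW T0) le_lm_lp lpn.
  set rho := \sum_(_ <= _ < _) _ in rho_le.
  have rho0 : 0 <= rho by apply: sumr_ge0 => i _; rewrite invr_ge0 edge_ge0.
  rewrite /hp hit_meanE (big_cat_nat (leq0n lm) le_lm_lp) /= -hit_meanE -/hm lerD2l.
  apply: (@le_trans _ _ rho).
    apply: ler_sum => i _; rewrite ler_piMl ?invr_ge0 ?edge_ge0 //.
    exact: mass_le1 rbd.
  rewrite ler_pdivlMr ?exprn_gt0 //; apply: le_trans rho_le.
  rewrite mulrC ler_wpM2r // expr2 ler_pM ?(ltW d0) //; lra.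
have vm_le : hit_var P pi lm 0 <= 8 * s ^+ 2 / delta.
  apply: le_trans (hit_var_le poinT (ltW T0) d0 lmn _) _; first by lra.
  rewrite -/hm sE mulrAC ler_wpM2r ?invr_ge0 ?(ltW d0) //.
  by have := ler_wpM2l (ltW T0) hm_le; lra.
have dd : 0 < delta ^+ 2 by rewrite exprn_gt0.
have hp_le' : hp <= 6 * t1%:R / delta ^+ 2.
  rewrite ler_pdivlMr //; have := ler_wpM2r (ltW dd) hp_le.
  rewrite mulrDl divfK ?gt_eqF //.
  have : hm * delta ^+ 2 <= 2 * t1%:R * 1.
    by rewrite ler_pM // ?(ltW dd) // expr_le1 // ltW.
  by lra.
have vp_le : hit_var P pi lp 0 <= 24 * s ^+ 2 / delta ^+ 3.
  apply: le_trans (hit_var_le poinT (ltW T0) d0 lpn _) _; first by lra.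
  rewrite -/hp sE.
  have -> : 24 * (T * t1%:R) / delta ^+ 3 = 4 * T / delta * (6 * t1%:R / delta ^+ 2).
    by field; rewrite gt_eqF.
  by rewrite ler_wpM2l // divr_ge0 ?mulr_ge0 // ltW.
have le_Ts : T <= 2 * s.
  rewrite -ler_sqr ?nnegrE ?mulr_ge0 ?(ltW T0) ?(ltW s0) // exprMn sE.
  by have := ler_wpM2l (ltW T0) le_Tt1; have := mulr_gt0 T0 t1_gt0; lra.
have hm_t0 : hm <= t0%:R + 2 * s / delta.
  have [le_vm|] := lower_tail rbd t0 lmn; last first.
    by move/le_trans; apply; rewrite lerDl divr_ge0 ?mulr_ge0 // ltW.
  rewrite -lerBlDl leNgt; apply/negP => lt_h.
  (* The factor 2 is large enough for a contradiction: 3 times 4 exceeds the 8 of [vm_le]. *)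
  have: 3 * delta * (2 * s / delta) ^+ 2 <= 8 * s ^+ 2 / delta.
    apply: le_trans vm_le; apply: le_trans le_vm.
    have := mix0 lm => c_le; apply: ler_pM; [lra | exact: sqr_ge0 | lra |].
    rewrite ler_sqr ?nnegrE; first exact: ltW.
      by rewrite divr_ge0 ?mulr_ge0 // ltW.
    by rewrite (le_trans _ (ltW lt_h)) // divr_ge0 ?mulr_ge0 // ltW.
  have -> : 3 * delta * (2 * s / delta) ^+ 2 = 12 * s ^+ 2 / delta.
    by field; rewrite gt_eqF.
  by rewrite ler_pM2r ?invr_gt0 //; have := exprn_gt0 2 s0; lra.
have hp_t : 5 * s / delta ^+ 2 <= t%:R - hp.
  have : 2 * s / delta <= 2 * s / delta ^+ 2.
    rewrite ler_wpM2l ?mulr_ge0 ?(ltW s0) // lef_pV2 ?posrE //.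
    by rewrite expr2 ler_piMl // ltW.
  have : 2 * T / delta ^+ 2 <= 4 * s / delta ^+ 2.
    by rewrite ler_wpM2r ?invr_ge0 ?(ltW dd) //; lra.
  by lra.
have a0 : 0 < 5 * s / delta ^+ 2 by rewrite divr_gt0 ?mulr_gt0.
have := upper_tail rbd k lpn (_ : hit_mean P pi lp 0 <= t%:R).
rewrite -/hp => /(_ ltac:(lra)) le_vp.
rewrite leNgt; apply/negP => lt_cdf.
(* Of the excess 2 [delta], one [delta] pays for the mass beyond [lp]. The square of 5 exceeds the
   24 of [vp_le]. *)
have : delta * (5 * s / delta ^+ 2) ^+ 2 <= 24 * s ^+ 2 / delta ^+ 3.
  apply: le_trans vp_le; apply: le_trans le_vp.
  apply: ler_pM; [lra | exact: sqr_ge0 | lra |].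
  by rewrite ler_sqr ?nnegrE //; lra.
have -> : delta * (5 * s / delta ^+ 2) ^+ 2 = 25 * s ^+ 2 / delta ^+ 3.
  by field; rewrite gt_eqF.
by rewrite ler_pM2r ?invr_gt0 ?exprn_gt0 //; have := exprn_gt0 2 s0; lra.
Qed.

End Fluctuations.

(** * Quadratic forms and maximizers of Rayleigh quotients *)

Section Rayleigh.
Variable R : realType.

(** Each |x_i x_j| is at most the sum of squares; the added 1 keeps [M] positive when [A] is
    zero. *)
Lemma form_le n (A : 'M[R]_n.+1) : exists2 M, 0 < M &
  forall x : 'rV[R]_n.+1, (x *m A *m x^T) 0 0 <= M * \sum_i x 0 i ^+ 2.
Proof.
exists (1 + \sum_j \sum_i `|A i j|) => [|x].
  by rewrite ltr_pwDl // sumr_ge0 // => j _; exact: sumr_ge0.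
have sq_le i : x 0 i ^+ 2 <= \sum_i x 0 i ^+ 2.
  by rewrite (bigD1 i) //= lerDl sumr_ge0 // => j _; exact: sqr_ge0.
have sum_ge0 : 0 <= \sum_i x 0 i ^+ 2 by apply: sumr_ge0 => i _; exact: sqr_ge0.
rewrite mulrDl mul1r -[leLHS]add0r lerD // mxE mulr_suml.
apply: ler_sum => j _; rewrite !mxE mulr_suml mulr_suml; apply: ler_sum => i _.
rewrite mulrAC mulrC (le_trans (ler_norm _)) // normrM ler_wpM2l //.
have := sq_le i; have := sq_le j; have := sqr_ge0 (x 0 i + x 0 j).
have := sqr_ge0 (x 0 i - x 0 j) => ? ? ? ?.
by rewrite ler_norml; apply/andP; split; lra.
Qed.

(* If the supremum mu of the Rayleigh quotient were not attained, the
   nonnegative form B = mu D - S would be invertible, hence coercive, and mu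
   could be lowered. *)
Lemma rayleigh_max n (S : 'M[R]_n.+1) (w : 'rV[R]_n.+1) :
  S^T = S -> (forall i, 0 < w 0 i) ->
  exists mu, exists2 y : 'rV[R]_n.+1,
    y != 0 /\ y *m S = mu *: (y *m diag_mx w) &
    forall x : 'rV[R]_n.+1, (x *m S *m x^T) 0 0 <= mu * \sum_i w 0 i * x 0 i ^+ 2.
Proof.
move=> symS w0; pose N (x : 'rV[R]_n.+1) := \sum_i w 0 i * x 0 i ^+ 2.
pose q (A : 'M[R]_n.+1) (x : 'rV[R]_n.+1) := (x *m A *m x^T) 0 0.
have N_ge0 x : 0 <= N x.
  by apply: sumr_ge0 => i _; rewrite mulr_ge0 ?sqr_ge0 // ltW.
have N_eq0 x : N x = 0 -> x = 0.
  move=> Nx; apply/rowP => i; rewrite mxE; apply/eqP.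
  have Ni : w 0 i * x 0 i ^+ 2 = 0.
    by apply: (psumr_eq0P _ Nx) => // j _; rewrite mulr_ge0 ?sqr_ge0 // ltW.
  by move/eqP: Ni; rewrite mulf_eq0 gt_eqF //= sqrf_eq0.
have ND x : q (diag_mx w) x = N x.
  rewrite /q mxE; apply: eq_bigr => i _; rewrite mul_mx_diag !mxE; ring.
have [K K0 leK] : exists2 K, 0 < K & forall x : 'rV[R]_n.+1, \sum_i x 0 i ^+ 2 <= K * N x.
  exists (1 + \sum_i (w 0 i)^-1) => [|x].
    by rewrite ltr_pwDl // sumr_ge0 // => i _; rewrite invr_ge0 ltW.
  rewrite mulrDl mul1r -[leLHS]add0r lerD // mulr_suml; apply: ler_sum => i _.
  rewrite [leRHS]mulrC ler_pdivlMr // [leLHS]mulrC /N (bigD1 i) //= lerDl sumr_ge0 // => j _.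
  by rewrite mulr_ge0 ?sqr_ge0 // ltW.
have [W W0 leW] : exists2 W, 0 < W & forall x, N x <= W * \sum_i x 0 i ^+ 2.
  by have [W W0 leW] := form_le (diag_mx w); exists W => // x; rewrite -ND; exact: leW.
have [M M0 leM] := form_le S.
pose E := [set mu | exists2 x, 0 < N x & mu * N x <= q S x]%classic.
have supE : has_sup E.
  split.
    pose x : 'rV[R]_n.+1 := delta_mx 0 0.
    have Nx : 0 < N x.
      rewrite lt_neqAle N_ge0 andbT eq_sym; apply/eqP => /N_eq0 /rowP /(_ 0).
      by rewrite !mxE eqxx => /eqP; rewrite oner_eq0.
    by exists (q S x / N x); exists x => //; rewrite divfK ?gt_eqF.
  exists (M * K) => mu [x Nx]; move/le_trans => /(_ _ (leM x)).
  move/le_trans => /(_ (M * K * N x)); rewrite -mulrA ler_wpM2l ?(ltW M0) //.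
  by move=> /(_ isT); rewrite mulrA ler_pM2r.
pose mu := sup E.
have q_le x : q S x <= mu * N x.
  have [Nx|] := ltP 0 (N x).
    rewrite -ler_pdivrMr //; apply: sup_upper_bound => //.
    by exists x => //; rewrite divfK ?gt_eqF.
  move=> Nx; have /N_eq0 -> : N x = 0 by apply/eqP; rewrite eq_le Nx N_ge0.
  rewrite /q !mul0mx mxE /N big1 ?mulr0 // => i _.
  by rewrite mxE expr0n mulr0.
pose B := mu *: diag_mx w - S.
have qB x : q B x = mu * N x - q S x.
  by rewrite /q mulmxBr mulmxBl -scalemxAr -scalemxAl !mxE -ND /q !mxE.
have [/eqP/det0P[y y0 yB]|] := eqVneq (\det B) 0.
  exists mu, y => //; split => //.
  by move/eqP: yB; rewrite mulmxBr -scalemxAr subr_eq0 => /eqP.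
rewrite -unitfE -unitmxE => unitB; exfalso.
have symB : B^T = B by rewrite /B linearB linearZ /= symS tr_diag_mx.
have [L L0 leL] := form_le (invmx B).
clearbody B; have coercive x : N x <= W * L * q B x.
  apply: le_trans (leW x) _; rewrite -mulrA ler_wpM2l ?(ltW W0) //.
  set p := \sum_i _; pose z := x *m invmx B.
  have pE : p = (x *m x^T) 0 0 by rewrite mxE; apply: eq_bigr => i _; rewrite mxE expr2.
  have zB : z *m B = x by rewrite /z mulmxKV.
  have zT : z^T = invmx B *m x^T by rewrite /z trmx_mul trmx_inv symB.
  have xBz : (x *m B *m z^T) 0 0 = p by rewrite pE zT mulmxA mulmxK.
  have zBx : (z *m B *m x^T) 0 0 = p by rewrite zB pE.
  have zBz : (z *m B *m z^T) 0 0 <= L * p.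
    by rewrite zB zT mulmxA; exact: leL.
  (* Expanding the nonnegative form at this point, with [z] the image of [x] under the inverse of
     [B], leaves [p / L <= q B x]. *)
  have : 0 <= q B (x - L^-1 *: z) by rewrite qB subr_ge0.
  have -> : q B (x - L^-1 *: z) =
      q B x - 2 * L^-1 * p + L^-1 ^+ 2 * (z *m B *m z^T) 0 0.
    rewrite /q [(_ - _)^T]linearB /= [(_ *: _)^T]linearZ /= !(mulmxBl, mulmxBr) -!scalemxAl -!scalemxAr.
    have -> : 2 * L^-1 * p = L^-1 * (x *m B *m z^T) 0 0 + L^-1 * (z *m B *m x^T) 0 0.
      by rewrite xBz zBx; ring.
    move: (x *m B *m x^T) (x *m B *m z^T) (z *m B *m x^T) (z *m B *m z^T).
    by move=> a b c d; rewrite !mxE; ring.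
  have : L^-1 ^+ 2 * (z *m B *m z^T) 0 0 <= L^-1 * p.
    rewrite expr2 -mulrA ler_wpM2l ?invr_ge0 ?(ltW L0) //.
    by rewrite mulrC ler_pdivrMr // mulrC.
  move=> le1 le2; have : L^-1 * p <= q B x by lra.
  by rewrite mulrC ler_pdivrMr // mulrC.
have WL0 : 0 < W * L by rewrite mulr_gt0.
(* By coercivity the right side still bounds [E] from above, although it lies below the supremum. *)
have : mu <= mu - (W * L)^-1.
  apply: ge_sup; first by case: supE.
  move=> e [x Nx le_e]; rewrite -(ler_pM2r Nx); apply: le_trans le_e _.
  have := coercive x; rewrite qB -ler_pdivrMl // mulrBl; lra.
by rewrite lerBrDr gerDl leNgt invr_gt0 WL0.
Qed.

End Rayleigh.

(** * Total variation, spectral gap and the Poincare inequality *)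

Section SpectralGap.
Variables (R : realType) (n : nat).
Implicit Types (P : 'M[R]_n.+1) (mu nu pi v : 'rV[R]_n.+1) (t : nat).

(** The excess on [A] equals the deficit off [A], so twice the excess is at most the l1 norm. *)
Lemma tv_dist_event mu nu (A : pred 'I_n.+1) : \sum_x mu 0 x = \sum_x nu 0 x ->
  \sum_(x | A x) (mu 0 x - nu 0 x) <= tv_dist mu nu.
Proof.
move=> eq_total; rewrite /tv_dist mulrC ler_pdivlMr // mulr_natr mulr2n.
have : \sum_x (mu 0 x - nu 0 x) = 0 by rewrite sumrB eq_total subrr.
rewrite (bigID A) /= => /eqP; rewrite addr_eq0 => /eqP {2}->.
rewrite [leRHS](bigID A) /= lerD //.
  by apply: ler_sum => x _; exact: ler_norm.
by rewrite -sumrN; apply: ler_sum => x _; rewrite -normrN ler_norm.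
Qed.

Lemma tv_distE mu nu : \sum_x mu 0 x = \sum_x nu 0 x ->
  tv_dist mu nu = \sum_(x | nu 0 x < mu 0 x) (mu 0 x - nu 0 x).
Proof.
move=> eq_total; rewrite /tv_dist; apply: (canLR (mulKf _)); first by rewrite pnatr_eq0.
rewrite mulr_natl mulr2n.
have : \sum_x (mu 0 x - nu 0 x) = 0 by rewrite sumrB eq_total subrr.
rewrite (bigID (fun x => nu 0 x < mu 0 x)) /= => /eqP; rewrite addr_eq0 => /eqP {2}->.
rewrite [LHS](bigID (fun x => nu 0 x < mu 0 x)) /= -sumrN; congr (_ + _).
  by apply: eq_bigr => x lt_x; rewrite gtr0_norm // subr_gt0.
by apply: eq_bigr => x; rewrite -leNgt => le_x; rewrite ler0_norm // subr_le0.
Qed.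

Lemma tv_le_worst_dist P pi t x : tv_dist (row x (P ^+ t)) pi <= worst_dist P pi t.
Proof. exact: le_bigmax. Qed.

(** Evaluate at a maximum of |v|: orthogonality to [pi] lets [pi] be subtracted from the row of
    [P ^+ t], and the difference has l1 norm at most 1/2. *)
Lemma eigen_decay P pi t (a : R) v :
  worst_dist P pi t <= 4^-1 -> v != 0 -> v *m P^T = a *: v ->
  \sum_x pi 0 x * v 0 x = 0 -> `|a| ^+ t <= 2^-1.
Proof.
move=> mix v0 vP pv.
have vPt s : v *m (P ^+ s)^T = a ^+ s *: v.
  elim: s => [|s IHs]; first by rewrite !expr0 trmx1 mulmx1 scale1r.
  by rewrite exprSr trmx_mul mulmxA vP -scalemxAl IHs scalerA exprS.
have [x _ vmax] := @arg_maxP _ _ _ (0 : 'I_n.+1) predT (fun x => `|v 0 x|) isT.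
have vx : 0 < `|v 0 x|.
  rewrite lt_neqAle normr_ge0 andbT eq_sym; apply: contra_neq v0 => vx.
  apply/rowP => y; rewrite mxE; apply/eqP; rewrite -normr_le0 -vx.
  exact: (vmax y isT).
rewrite -(ler_pM2r vx) -normrX -normrM.
have -> : a ^+ t * v 0 x = \sum_y ((P ^+ t) x y - pi 0 y) * v 0 y.
  have := congr1 (fun u : 'rV_n.+1 => u 0 x) (vPt t); rewrite !mxE => <-.
  under [RHS]eq_bigr do rewrite mulrBl; rewrite sumrB pv subr0.
  by apply: eq_bigr => y _; rewrite mxE mulrC.
apply: le_trans (ler_norm_sum _ _ _) _.
have := le_trans (tv_le_worst_dist P pi t x) mix.
rewrite /tv_dist => le_tv; apply: (@le_trans _ _ (\sum_y `|row x (P ^+ t) 0 y - pi 0 y| * `|v 0 x|)).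
  apply: ler_sum => y _; rewrite normrM mxE ler_wpM2l //.
  exact: (vmax y isT).
by rewrite -mulr_suml ler_pM2r //; lra.
Qed.

(** Bernoulli's inequality, which turns b^t <= 1/2 into 1 - b >= 1/(2t). *)
Lemma bernoulli_le (b : R) t : 0 <= b -> 1 - t%:R * (1 - b) <= b ^+ t.
Proof.
move=> b0; elim: t => [|t IHt]; first by rewrite mul0r subr0 expr0.
have := ler_wpM2l b0 IHt; rewrite -exprS; apply: le_trans.
have : 0 <= t%:R * (1 - b) ^+ 2 by rewrite mulr_ge0 ?sqr_ge0.
by rewrite -natr1; lra.
Qed.

Section Mixing.
Variables (P : 'M[R]_n.+1) (pi : 'rV[R]_n.+1) (t : nat).
Hypothesis rbd : reversible_bd P pi.
Hypothesis mix : worst_dist P pi t <= 4^-1.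

(** Stationarity makes the [pi]-mean of an eigenfunction equal to [a] times itself, hence zero. *)
Lemma eigenvalue_mixing (a : R) : eigenvalue P^T a -> a != 1 -> `|a| ^+ t <= 2^-1.
Proof.
move=> /eigenvalueP[v vP v0] a1; apply: (eigen_decay mix v0 vP).
have : \sum_x pi 0 x * v 0 x = a * \sum_x pi 0 x * v 0 x.
  have piPv : pi *m (v *m P^T)^T = pi *m v^T.
    by rewrite trmx_mul trmxK mulmxA (rbd_stationary rbd).
  have := congr1 (fun u : 'M_1 => u 0 0) piPv; rewrite vP !mxE.
  under eq_bigr do rewrite !mxE mulrCA; rewrite -mulr_sumr => ->.
  by apply: eq_bigr => x _; rewrite mxE.
move=> /eqP; rewrite -subr_eq0 -{1}[\sum_x _]mul1r -mulrBl mulf_eq0 subr_eq0 eq_sym.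
by rewrite (negPf a1) /= => /eqP.
Qed.

(** At time 0 both end states, which are distinct, would have stationary mass at least 3/4. *)
Lemma mixing_time_gt0 : (0 < n)%N -> (0 < t)%N.
Proof.
move=> n0; rewrite lt0n; apply/eqP => t0; move: mix; rewrite t0 => mix0.
have total x : \sum_y row x (P ^+ 0) 0 y = \sum_y pi 0 y.
  rewrite (rbd_sum1 rbd) -[RHS](proj2 (transition_kernelX 0 (proj1 (rbd_bd rbd))) x).
  by apply: eq_bigr => y _; rewrite mxE.
have pi_big x : 1 - pi 0 x <= 4^-1.
  have := tv_dist_event (pred1 x) (total x); rewrite big_pred1_eq expr0 !mxE eqxx.
  by move/le_trans; apply; rewrite -(expr0 P); exact: le_trans (tv_le_worst_dist _ _ _ _) mix0.
have := pi_big 0; have := pi_big ord_max; have := rbd_sum1 rbd.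
rewrite (bigD1 0) //= (bigD1 ord_max) /=; last by rewrite -val_eqE /= -lt0n.
have : 0 <= \sum_(i < n.+1 | (i != 0) && (i != ord_max)) pi 0 i.
  by apply: sumr_ge0 => x _; rewrite ltW // (rbd_gt0 rbd).
by move: (\sum_(i | _) _) => s; lra.
Qed.

Lemma second_eigenvalue_le : (0 < n)%N ->
  second_eigenvalue P <= 1 - (2 * t%:R)^-1.
Proof.
move=> n0; have t0 : 0 < t%:R :> R by rewrite ltr0n mixing_time_gt0.
have bound a : eigenvalue P^T a -> a != 1 -> `|a| <= 1 - (2 * t%:R)^-1.
  move=> Pa a1; have := eigenvalue_mixing Pa a1.
  have /le_trans le := bernoulli_le t (normr_ge0 a); move=> /le {}le.
  have : (2 * t%:R)^-1 <= 1 - `|a|.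
    by rewrite invfM ler_pdivrMr // mulrC; lra.
  by lra.
rewrite /second_eigenvalue; set E := (X in sup X).
(* The [sup] of the empty set is 0, and the bound is nonnegative because t >= 1. *)
have [->|/set0P E0] := eqVneq E set0%classic.
  rewrite sup0 subr_ge0 invf_le1 ?mulr_gt0 //.
  have : 1 <= t%:R :> R by rewrite ler1n mixing_time_gt0.
  by lra.
by apply: ge_sup => // _ [a /andP[Pa a1] <-]; exact: bound.
Qed.

Lemma second_eigenvalue_ge0 : 0 <= second_eigenvalue P.
Proof.
rewrite /second_eigenvalue; set E := (X in sup X).
have [supE|/sup_out->//] := pselect (has_sup E).
have [e Ee] := proj1 supE.
apply: le_trans (sup_upper_bound supE Ee).
by case: Ee => a _ <-.
Qed.

Lemma gap_gt0 : (0 < n)%N -> 0 < gap P.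
Proof.
move=> n0; rewrite subr_gt0; apply: le_lt_trans (second_eigenvalue_le n0) _.
by rewrite ltrBlDr ltrDl invr_gt0 mulr_gt0 // ltr0n mixing_time_gt0.
Qed.

Lemma trel_le : (0 < n)%N -> trel P <= 2 * t%:R.
Proof.
move=> n0; have t0 : 0 < t%:R :> R by rewrite ltr0n mixing_time_gt0.
rewrite -[leRHS]invrK lef_pV2 ?posrE ?gap_gt0 ?invr_gt0 ?mulr_gt0 //.
by rewrite /gap; have := second_eigenvalue_le n0; lra.
Qed.

Lemma trel_ge1 : (0 < n)%N -> 1 <= trel P.
Proof.
move=> n0; rewrite /trel invf_ge1 ?gap_gt0 // /gap.
by have := second_eigenvalue_ge0; lra.
Qed.

(* The second eigenvalue dominates the Rayleigh quotient of P - 1 pi, whose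
   eigenvectors for nonzero eigenvalues are those of P orthogonal to 1. *)
Lemma rayleigh_le (f : 'I_n.+1 -> R) :
  \sum_x \sum_y pi 0 x * P x y * (f x * f y) - (\sum_x pi 0 x * f x) ^+ 2 <=
  second_eigenvalue P * \sum_x pi 0 x * f x ^+ 2.
Proof.
pose S : 'M[R]_n.+1 := \matrix_(x, y) (pi 0 x * P x y - pi 0 x * pi 0 y).
have symS : S^T = S.
  by apply/matrixP => x y; rewrite !mxE (rbd_balance rbd) [X in _ - X]mulrC.
have [mu [y [y0 yS] mu_max]] := rayleigh_max symS (rbd_gt0 rbd).
have := mu_max (\row_x f x).
have -> : (\row_x f x *m S *m (\row_x f x)^T) 0 0 =
    \sum_x \sum_y pi 0 x * P x y * (f x * f y) - (\sum_x pi 0 x * f x) ^+ 2.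
  rewrite expr2 big_distrlr -sumrB mxE; under eq_bigr do rewrite mxE mulr_suml.
  rewrite exchange_big; apply: eq_bigr => i _ /=.
  by rewrite -sumrB; apply: eq_bigr => j _; rewrite !mxE; ring.
under [in leRHS]eq_bigr do rewrite mxE.
move/le_trans; apply.
rewrite ler_wpM2r //.
  by apply: sumr_ge0 => x _; rewrite mulr_ge0 ?sqr_ge0 // ltW // (rbd_gt0 rbd).
have [mu_le0|mu_gt0] := leP mu 0; first exact: le_trans second_eigenvalue_ge0.
pose m := \sum_x pi 0 x * y 0 x.
have eigen z : \sum_x P z x * y 0 x - m = mu * y 0 z.
  have := congr1 (fun u : 'rV_n.+1 => u 0 z) yS.
  rewrite mul_mx_diag !mxE; under eq_bigr do rewrite mxE.
  move=> E; have piz : pi 0 z != 0 by rewrite gt_eqF // (rbd_gt0 rbd).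
  apply: (mulIf piz); rewrite -mulrA -E mulrBl !mulr_suml -sumrB.
  by apply: eq_bigr => x _; rewrite (rbd_balance rbd); ring.
(* Averaging [eigen] against [pi] gives [mu * m = m - m], and [mu] is positive. *)
have m0 : m = 0.
  have : \sum_z pi 0 z * (mu * y 0 z) = 0.
    under eq_bigr do rewrite -eigen mulrBr mulr_sumr.
    rewrite sumrB -mulr_suml (rbd_sum1 rbd) mul1r exchange_big /=.
    apply/eqP; rewrite subr_eq0; apply/eqP; apply: eq_bigr => x _.
    under eq_bigr do rewrite mulrA (rbd_balance rbd).
    by rewrite -mulr_suml -mulr_sumr (proj2 (proj1 (rbd_bd rbd))) mulr1.
  under eq_bigr do rewrite mulrCA; rewrite -mulr_sumr => /eqP.
  by rewrite mulf_eq0 gt_eqF //= => /eqP.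
have yP : y *m P^T = mu *: y.
  apply/rowP => z; rewrite !mxE -eigen m0 subr0.
  by apply: eq_bigr => x _; rewrite mxE mulrC.
have mu_half : `|mu| ^+ t <= 2^-1 by exact: eigen_decay mix y0 yP m0.
have mu1 : mu != 1.
  by apply/eqP => mu1; move: mu_half; rewrite mu1 normr1 expr1n; lra.
rewrite -[leLHS](gtr0_norm mu_gt0); apply: ub_le_sup; last first.
  by exists mu => //=; rewrite mu1 andbT; apply/eigenvalueP; exists y.
exists 1 => _ [a /andP[Pa a1] <-].
rewrite leNgt; apply/negP => lt1; have := eigenvalue_mixing Pa a1.
by have := exprn_ege1 t (ltW lt1); lra.
Qed.

(** After centring, the two double sums are [2 * B] and [2 * (B - A)], and [rayleigh_le] bounds [A]
    by the second eigenvalue times [B]. *)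
Lemma poincare_trel : (0 < n)%N -> poincare P pi (trel P).
Proof.
move=> n0 f; pose m := \sum_x pi 0 x * f x; pose g x := f x - m.
have gm : \sum_x pi 0 x * g x = 0.
  under eq_bigr do rewrite mulrBr.
  by rewrite sumrB -mulr_suml (rbd_sum1 rbd) mul1r subrr.
have fg x y : f x - f y = g x - g y by rewrite /g; ring.
under eq_bigr do under eq_bigr do rewrite fg.
under [in leRHS]eq_bigr do under eq_bigr do rewrite fg.
pose B := \sum_x pi 0 x * g x ^+ 2.
pose A := \sum_x \sum_y pi 0 x * P x y * (g x * g y).
have P1 := proj2 (proj1 (rbd_bd rbd)).
have -> : \sum_x \sum_y pi 0 x * pi 0 y * (g x - g y) ^+ 2 = 2 * B.
  have B1 : \sum_x \sum_y pi 0 x * pi 0 y * g x ^+ 2 = B.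
    by apply: eq_bigr => x _; rewrite -mulr_suml -mulr_sumr (rbd_sum1 rbd) mulr1.
  have B2 : \sum_x \sum_y pi 0 x * pi 0 y * g y ^+ 2 = B.
    rewrite exchange_big -[RHS]B1; apply: eq_bigr => x _; apply: eq_bigr => y _.
    by rewrite [pi 0 y * _]mulrC.
  pose C := \sum_x \sum_y pi 0 x * g x * (pi 0 y * g y).
  have C0 : C = 0.
    by rewrite /C; under eq_bigr do rewrite -mulr_sumr gm mulr0; rewrite big1.
  have -> : 2 * B = B + B - 2 * C by rewrite C0; ring.
  rewrite -{1}B1 -B2 /C mulr_sumr -big_split -sumrB /=; apply: eq_bigr => x _.
  by rewrite mulr_sumr -big_split -sumrB /=; apply: eq_bigr => y _; ring.
have -> : \sum_x \sum_y pi 0 x * P x y * (g x - g y) ^+ 2 = 2 * (B - A).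
  have B1 : \sum_x \sum_y pi 0 x * P x y * g x ^+ 2 = B.
    apply: eq_bigr => x _.
    by rewrite -mulr_suml -mulr_sumr P1 mulr1.
  have B2 : \sum_x \sum_y pi 0 x * P x y * g y ^+ 2 = B.
    rewrite exchange_big -[RHS]B1; apply: eq_bigr => x _; apply: eq_bigr => y _.
    by rewrite (rbd_balance rbd).
  have -> : 2 * (B - A) = B + B - 2 * A by ring.
  rewrite -{1}B1 -B2 /A mulr_sumr -big_split -sumrB /=; apply: eq_bigr => x _.
  rewrite mulr_sumr -big_split -sumrB /=; apply: eq_bigr => y _; ring.
rewrite /trel ler_pdivlMl ?gap_gt0 //.
by have := rayleigh_le g; rewrite gm expr0n /= subr0 -/A -/B /gap; lra.
Qed.

End Mixing.
End SpectralGap.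

(** * Reversal of the state space, extremal starting points and convergence *)

Section Reversal.
Variables (R : realType) (n : nat).
Implicit Types (P : 'M[R]_n.+1) (pi : 'rV[R]_n.+1) (t k : nat).

Definition rev_kernel P : 'M[R]_n.+1 := \matrix_(x, y) P (rev_ord x) (rev_ord y).
Definition rev_dist pi : 'rV[R]_n.+1 := \row_x pi 0 (rev_ord x).

Lemma sum_rev (F : 'I_n.+1 -> R) : \sum_x F (rev_ord x) = \sum_x F x.
Proof. by rewrite [RHS](reindex_inj rev_ord_inj). Qed.

Lemma rev_kernelX P t : rev_kernel P ^+ t = rev_kernel (P ^+ t).
Proof.
elim: t => [|t IHt].
  by apply/matrixP => x y; rewrite !expr0 !mxE (inj_eq rev_ord_inj).
rewrite !exprS IHt; apply/matrixP => x y; rewrite !mxE -[RHS]sum_rev.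
by apply: eq_bigr => z _; rewrite !mxE.
Qed.

Lemma rev_reversible_bd P pi :
  reversible_bd P pi -> reversible_bd (rev_kernel P) (rev_dist pi).
Proof.
move=> rbd; have [[[P0 P1] Ptri] lazyP pi0 pi1 bal edge0] := rbd; split.
- split; [split => [x y|x]|].
  + by rewrite mxE.
  + by under eq_bigr do rewrite mxE; rewrite (sum_rev (P (rev_ord x))).
  + by move=> x y far; rewrite mxE Ptri //=; have := ltn_ord x; have := ltn_ord y; lia.
- by move=> x; rewrite mxE.
- by move=> x; rewrite mxE.
- by under eq_bigr do rewrite mxE; rewrite (sum_rev (pi 0)).
- by move=> x y; rewrite !mxE.
move=> k lt_kn; have kP : (k < n.+1)%N by exact: ltnW.
pose x : 'I_n.+1 := Ordinal kP; pose y : 'I_n.+1 := Ordinal (lt_kn : (k.+1 < n.+1)%N).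
rewrite (@edgeE _ _ _ _ x y) // !mxE bal -edgeE; last by rewrite /=; lia.
by apply: edge0; rewrite /=; lia.
Qed.

Lemma rev_poincare P pi T : poincare P pi T -> poincare (rev_kernel P) (rev_dist pi) T.
Proof.
move=> poinT f; have := poinT (fun x => f (rev_ord x)).
have sum2 (F : 'I_n.+1 -> 'I_n.+1 -> R) :
    \sum_x \sum_y F (rev_ord x) (rev_ord y) = \sum_x \sum_y F x y.
  by rewrite -[RHS]sum_rev; apply: eq_bigr => x _; rewrite -[RHS]sum_rev.
rewrite -sum2 -[X in _ <= T * X]sum2.
under eq_bigr do under eq_bigr do rewrite !rev_ordK.
under [X in _ <= T * X]eq_bigr do under eq_bigr do rewrite !rev_ordK.
under [X in _ -> X <= _]eq_bigr do under eq_bigr do rewrite !mxE.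
by under [X in _ -> _ <= T * X]eq_bigr do under eq_bigr do rewrite !mxE.
Qed.

Lemma rev_cdfE P t (x : 'I_n.+1) k :
  cdf (rev_kernel P) t (rev_ord x) k = \sum_(z | (rev_ord z < k)%N) (P ^+ t) x z.
Proof.
rewrite /cdf rev_kernelX [RHS](reindex_inj rev_ord_inj) /=.
by apply: eq_big => [z|z _]; rewrite ?mxE ?rev_ordK //; congr (_ < _)%N => /=; have := ltn_ord z; lia.
Qed.

Lemma rev_massE pi k : mass (rev_dist pi) k = \sum_(z | (rev_ord z < k)%N) pi 0 z.
Proof.
rewrite /mass [RHS](reindex_inj rev_ord_inj) /=.
by apply: eq_big => [z|z _]; rewrite ?mxE //; congr (_ < _)%N; have := ltn_ord z; lia.
Qed.

Lemma rev_ord_max : rev_ord (ord_max : 'I_n.+1) = 0.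
Proof. by apply: val_inj; rewrite /= subnn. Qed.

Lemma rev_threshold (z : 'I_n.+1) k : (rev_ord z < n.+1 - k)%N = ~~ (z < k)%N.
Proof. by rewrite /=; have := ltn_ord z; lia. Qed.

Section Threshold.
Variables (P : 'M[R]_n.+1) (pi : 'rV[R]_n.+1).
Hypothesis rbd : reversible_bd P pi.

Let kerP : transition_kernel P := proj1 (rbd_bd rbd).

Lemma sum_row t x : \sum_y row x (P ^+ t) 0 y = \sum_y pi 0 y.
Proof.
rewrite (rbd_sum1 rbd) -[RHS](proj2 (transition_kernelX t kerP) x).
by apply: eq_bigr => y _; rewrite mxE.
Qed.

Lemma event_le_worst_dist t x (A : pred 'I_n.+1) :
  \sum_(z | A z) (P ^+ t) x z <= \sum_(z | A z) pi 0 z + worst_dist P pi t.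
Proof.
rewrite -lerBlDl -sumrB; apply: le_trans (tv_le_worst_dist _ _ _ x).
apply: le_trans (tv_dist_event A (sum_row t x)).
by rewrite le_eqVlt; apply/orP; left; apply/eqP; apply: eq_bigr => z _; rewrite mxE.
Qed.

(* It suffices to control the two extremal starting points, on initial and
   final segments respectively. *)
Lemma worst_dist_le t (eta : R) :
  (forall k, cdf P t 0 k <= mass pi k + eta) ->
  (forall k, cdf (rev_kernel P) t 0 k <= mass (rev_dist pi) k + eta) ->
  worst_dist P pi t <= 2 * eta.
Proof.
move=> left_le right_le; have [Q0 Q1] := transition_kernelX t kerP.
have tpP := tp2_lazy_birth_and_death (rbd_bd rbd) (rbd_lazy rbd).
(* The first n + 1 - k states of the reversed chain form the complement of the first k states. *)
have right_ge k : mass pi k - eta <= cdf P t ord_max k.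
  have := right_le (n.+1 - k)%N; rewrite -rev_ord_max rev_cdfE rev_massE.
  under eq_bigl do rewrite rev_threshold.
  under [in leRHS]eq_bigl do rewrite rev_threshold.
  have := Q1 ord_max; have := rbd_sum1 rbd.
  rewrite (bigID (fun z : 'I_n.+1 => (z < k)%N)) /= -/(mass pi k) => Epi.
  rewrite (bigID (fun z : 'I_n.+1 => (z < k)%N)) /= -/(cdf P t ord_max k) => EP.
  by lra.
have event_xy (x y : 'I_n.+1) (A : pred 'I_n.+1) : (x <= y)%N ->
    \sum_(z | A z) ((P ^+ t) x z - (P ^+ t) y z) <= 2 * eta.
  move=> le_xy; have [k le_k] := event_le_threshold t A kerP tpP le_xy.
  have := @cdf_anti _ _ P t 0 x k kerP tpP (leq0n x).
  have := @cdf_anti _ _ P t y ord_max k kerP tpP (leq_ord y).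
  by have := left_le k; have := right_ge k; lra.
have event x y (A : pred 'I_n.+1) :
    \sum_(z | A z) ((P ^+ t) x z - (P ^+ t) y z) <= 2 * eta.
  have [|/ltnW le_yx] := leqP x y; first exact: event_xy.
  apply: le_trans (event_xy _ _ (fun z => ~~ A z) le_yx).
  have : \sum_z ((P ^+ t) x z - (P ^+ t) y z) = 0 by rewrite sumrB !Q1 subrr.
  rewrite (bigID A) /= => /eqP; rewrite addr_eq0 => /eqP ->.
  by rewrite -sumrN le_eqVlt; apply/orP; left; apply/eqP/eq_bigr => z _; rewrite opprB.
(* The maximum in [worst_dist] starts from 0, so its bound must be nonnegative. *)
have eta0 : 0 <= 2 * eta.
  by have := event 0 0 predT; rewrite big1 // => z _; rewrite subrr.
apply: bigmax_le => // x _; rewrite tv_distE ?sum_row //.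
set A := (fun z => pi 0 z < row x (P ^+ t) 0 z).
(* By stationarity [pi] is the [pi]-average of the rows of [P ^+ t]. *)
have -> : \sum_(z | A z) (row x (P ^+ t) 0 z - pi 0 z) =
    \sum_y pi 0 y * \sum_(z | A z) ((P ^+ t) x z - (P ^+ t) y z).
  under [RHS]eq_bigr do rewrite mulr_sumr.
  rewrite exchange_big; apply: eq_bigr => z _.
  under eq_bigr do rewrite mulrBr.
  rewrite sumrB -mulr_suml (rbd_sum1 rbd) mul1r mxE; congr (_ - _).
  by rewrite -[in LHS](stationaryX t (rbd_stationary rbd)) mxE.
have -> : 2 * eta = \sum_y pi 0 y * (2 * eta).
  by rewrite -mulr_suml (rbd_sum1 rbd) mul1r.
apply: ler_sum => y _.
by apply: ler_wpM2l; [exact: ltW (rbd_gt0 rbd y) | exact: event].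
Qed.

(** For [l = n] the loss term of [upper_tail] vanishes. The witness makes the distance b from [t] to
    the mean at least 1 + v/eta, whence eta b^2 >= eta + v > v. *)
Lemma cdf_eventually (eta : R) : 0 < eta ->
  exists a : R, forall t k, a <= t%:R -> cdf P t 0 k <= mass pi k + eta.
Proof.
move=> eta0; set h := hit_mean P pi n 0; set v := hit_var P pi n 0.
have v0 : 0 <= v by exact: hit_var_ge0.
exists (h + 1 + v / eta) => t k le_t; have ve : 0 <= v / eta by rewrite divr_ge0 // ltW.
have := upper_tail rbd k (leqnn n) (_ : h <= t%:R); rewrite (massT rbd) -/h -/v subrr subr0.
move=> /(_ ltac:(lra)) le_v; rewrite leNgt; apply/negP => lt_eta.
set b := t%:R - h in le_v.
have : eta * (1 + v / eta) <= v.
  have b1 : 1 + v / eta <= b by rewrite /b; lra.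
  have b_ge1 : 1 <= b by apply: le_trans b1; rewrite lerDl.
  apply: le_trans le_v; apply: (@le_trans _ _ (eta * b ^+ 2)).
    rewrite ler_wpM2l ?(ltW eta0) // (le_trans b1) // expr2 ler_peMl //.
    exact: le_trans b_ge1.
  by rewrite ler_wpM2r ?sqr_ge0 // lerBrDl ltW.
by rewrite mulrDr mulr1 mulrC divfK ?gt_eqF //; lra.
Qed.

End Threshold.

(** Convergence to stationarity, so that the set minimized in [tmix] is nonempty. *)
Lemma worst_dist_eventually P pi (eta : R) : reversible_bd P pi -> 0 < eta ->
  exists t, worst_dist P pi t <= eta.
Proof.
move=> rbd eta0; have eta2 : 0 < eta / 2 by rewrite divr_gt0.
have [a left_a] := cdf_eventually rbd eta2.
have [b right_b] := cdf_eventually (rev_reversible_bd rbd) eta2.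
pose t := (Num.truncn (`|a| + `|b|)).+1; exists t.
have lt_t : `|a| + `|b| < t%:R by rewrite -truncn_lt_nat // addr_ge0.
have := ler_norm a; have := ler_norm b; have := normr_ge0 a; have := normr_ge0 b => ? ? ? ?.
have -> : eta = 2 * (eta / 2) by rewrite mulrC divfK ?pnatr_eq0.
by apply: worst_dist_le => // k; [apply: left_a | apply: right_b]; lra.
Qed.

Lemma tmix_le P pi (eps : R) t : worst_dist P pi t <= eps -> (tmix P pi eps <= t)%N.
Proof.
move=> le_eps; rewrite /tmix; case: pselect => [ex_t|//].
by case: ex_minnP => m _; apply.
Qed.

Lemma worst_dist_tmix P pi (eps : R) : reversible_bd P pi -> 0 < eps ->
  worst_dist P pi (tmix P pi eps) <= eps.
Proof.
move=> rbd eps0; rewrite /tmix; case: pselect => [ex_t|[]].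
  by case: ex_minnP.
exact: worst_dist_eventually.
Qed.

End Reversal.

(** * The cutoff window from both extremal starting points *)

Theorem theorem1 (R : realType) (eps : R) (heps0 : 0 < eps) (heps1 : eps < 2^-1) :
  exists c : R, 0 < c /\
    forall (n : nat) (P : 'M[R]_n.+1) (pi : 'rV[R]_n.+1),
      (1 <= n)%N ->
      birth_and_death P -> lazy_chain P -> irreducible_chain P ->
      stationary_distribution P pi ->
      (tmix P pi eps)%:R - (tmix P pi (1 - eps))%:R
        <= c * Num.sqrt (trel P * (tmix P pi 4^-1)%:R).
Proof.
(* Each extremal start contributes 2 [delta], which [worst_dist_le] doubles to 4 [delta] = [eps]. *)
pose delta := eps / 4; have d0 : 0 < delta by rewrite divr_gt0.
have d8 : delta <= 8^-1 by rewrite /delta; lra.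
have dd : 0 < delta ^+ 2 by rewrite exprn_gt0.
(* The 12 is the 11 of [cutoff_window_left] plus 1 for rounding to an integer time, since 1 is at
   most [s / delta ^+ 2]. *)
exists (12 / delta ^+ 2); split; first by rewrite divr_gt0.
move=> n P pi n0 bdP lazyP irrP statP.
have rbd := irreducible_reversible_bd bdP lazyP irrP statP.
set t0 := tmix P pi (1 - eps); set t1 := tmix P pi 4^-1.
have mix0 : worst_dist P pi t0 <= 1 - eps by apply: worst_dist_tmix => //; lra.
have mix1 : worst_dist P pi t1 <= 4^-1 by apply: worst_dist_tmix => //; lra.
have T1 := trel_ge1 rbd mix1 n0; have Tt1 := trel_le rbd mix1 n0.
have poinT := poincare_trel rbd mix1 n0.
have t1_ge1 : 1 <= t1%:R :> R by rewrite ler1n (mixing_time_gt0 rbd mix1 n0).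
have T0 : 0 < trel P by exact: lt_le_trans T1.
set s := Num.sqrt _.
have s1 : 1 <= s by rewrite -sqrtr1 ler_wsqrtr // mulr_ege1.
pose w := 11 * s / delta ^+ 2.
have w0 : 0 <= w by rewrite /w divr_ge0 ?(ltW dd) // mulr_ge0 //; lra.
pose t := (t0 + (Num.truncn w).+1)%N.
have le_t : t0%:R + w <= t%:R by rewrite natrD lerD2l ltW // -truncn_lt_nat.
have t_le : t%:R <= t0%:R + w + 1.
  by rewrite natrD -natr1 addrA lerD2r lerD2l truncn_le.
have eps_delta : eps = 4 * delta by rewrite /delta mulrC divfK ?pnatr_eq0.
have worst_t : worst_dist P pi t <= eps.
  have -> : eps = 2 * (2 * delta) by rewrite eps_delta; ring.
  have dB : 0 < delta <= 8^-1 by apply/andP.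
  apply: worst_dist_le => // k.
    apply: (cutoff_window_left rbd k poinT T0 Tt1 dB _ _ le_t) => j; rewrite /cdf.
      exact: le_trans (event_le_worst_dist rbd _ _ _) (lerD (lexx _) mix1).
    rewrite -eps_delta.
    exact: le_trans (event_le_worst_dist rbd _ _ _) (lerD (lexx _) mix0).
  apply: (cutoff_window_left (rev_reversible_bd rbd) k (rev_poincare poinT) T0 Tt1 dB _ _ le_t) => j.
    rewrite -rev_ord_max rev_cdfE rev_massE.
    exact: le_trans (event_le_worst_dist rbd _ _ _) (lerD (lexx _) mix1).
  rewrite -eps_delta -rev_ord_max rev_cdfE rev_massE.
  exact: le_trans (event_le_worst_dist rbd _ _ _) (lerD (lexx _) mix0).
have le_tmix : (tmix P pi eps)%:R <= t%:R :> R by rewrite ler_nat tmix_le.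
have : 1 <= s / delta ^+ 2.
  rewrite ler_pdivlMr // mul1r (le_trans _ s1) // expr_le1 ?(ltW d0) //; lra.
by rewrite /w in t_le; lra.
Qed.
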